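(* Let $p$ be a prime, let $C,\gamma>0$, and for $t>0$ let $f_t^{(p)}$ be the continuous density, with respect to Haar measure, of the probability measure $\rho_t^{(p)}$ on $\mathbb{Q}_p$ with Fourier transform $\widehat{\rho_t^{(p)}}(\chi_y)=\exp\{-Ct|y|_p^{\gamma}\}$, $y\in\mathbb{Q}_p$; that is, $f_t^{(p)}(x)=\int_{\mathbb{Q}_p}\chi_y(x)e^{-Ct|y|_p^{\gamma}}\,dy$. Then for each $t>0$ and $x\in\mathbb{Q}_p\setminus\{0\}$, $$f_t^{(p)}(x)=\sum_{n=0}^{\infty}\frac{(-1)^n}{n!}\,\frac{(Ct)^{n}}{|x|_p^{n\gamma+1}}\,\Gamma_p(n\gamma+1).$$
   Context: $\mathbb{Q}_p$ is the additive group of $p$-adic numbers with the $p$-adic norm $|\cdot|_p$ ($|p|_p=1/p$), and Haar measure is normalized so that $\mathbb{Z}_p=\{x:|x|_p\le1\}$ has mass $1$. For $x\in\mathbb{Q}_p$, $[x]$ denotes the $p$-adic fractional part of $x$, and $\chi_y(x)=e^{2\pi i[xy]}$. The Fourier transform of a finite Borel measure $\mu$ on $\mathbb{Q}_p$ is $\widehat{\mu}(\chi_y)=\int_{\mathbb{Q}_p}\chi_y(-x)\,\mu(dx)$. $\Gamma_p$ is the Gel'fand--Graev gamma function, $\Gamma_p(s)=\int_{\mathbb{Q}_p}\chi_1(x)|x|_p^{s-1}\,dx$ (interpreted as a conditionally convergent integral), which for real $s>0$ is given by $\Gamma_p(s)=\dfrac{1-p^{s-1}}{1-p^{-s}}$.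 *)

(* Defs.v *)
From HB Require Import structures.
From mathcomp Require Import all_boot all_order all_algebra.
From mathcomp Require Import generic_quotient ring_quotient.
From mathcomp Require Import complex ring.
From mathcomp Require Import all_classical all_reals all_analysis.

Set Implicit Arguments.
Unset Strict Implicit.
Unset Printing Implicit Defensive.

Import Order.TTheory GRing.Theory Num.Theory.
Import numFieldNormedType.Exports.

Local Open Scope classical_set_scope.
Local Open Scope ring_scope.
Local Open Scope quotient_scope.

Section RatNorm.
Variables (R : realType) (p : nat).

(* For p prime, the p-adic absolute value |p^v a/b|_p = p^-v (a, b prime to p).
   For p not prime, logn p is 0 and this is the trivial absolute value. *)
Definition ratnorm (q : rat) : R :=
  if q == 0 then 0
  else p%:R ^ ((logn p `|denq q|)%:Z - (logn p `|numq q|)%:Z).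

Lemma ratnorm0 : ratnorm 0 = 0. Proof. by rewrite /ratnorm eqxx. Qed.

Lemma lognp0 : p = 0%N -> forall n, logn p n = 0%N.
Proof. by move=> -> n; rewrite lognE. Qed.

Lemma ratnorm_gt0 q : q != 0 -> 0 < ratnorm q.
Proof.
move=> q0; rewrite /ratnorm (negbTE q0).
have [p0|p0] := posnP p; first by rewrite !(lognp0 p0) subrr expr0z.
by rewrite exprz_gt0 // ltr0n.
Qed.

Lemma ratnorm_ge0 q : 0 <= ratnorm q.
Proof.
by have [->|/ratnorm_gt0/ltW//] := eqVneq q 0; rewrite ratnorm0.
Qed.

Lemma ratnorm_eq0 q : (ratnorm q == 0) = (q == 0).
Proof.
have [->|q0] := eqVneq q 0; first by rewrite ratnorm0 eqxx.
by apply/negbTE; rewrite gt_eqF// ratnorm_gt0.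
Qed.

Lemma ratnorm_frac (x d : int) : x != 0 -> d != 0 ->
  ratnorm (x%:~R / d%:~R) = p%:R ^ ((logn p `|d|)%:Z - (logn p `|x|)%:Z).
Proof.
move=> x0 d0; set q := x%:~R / d%:~R.
have q0 : q != 0 by rewrite mulf_neq0 ?invr_eq0 ?intr_eq0.
rewrite /ratnorm (negbTE q0); congr (_ ^ _).
have e : numq q * d = x * denq q.
  apply/eqP; rewrite -(eqr_int rat) !rmorphM /=; apply/eqP.
  have := divq_num_den q; rewrite {3}/q => /eqP.
  by rewrite eqr_div ?intr_eq0 ?denq_eq0// => /eqP.
have : (logn p (`|numq q| * `|d|) = logn p (`|x| * `|denq q|))%N.
  by rewrite -!abszM e.
rewrite !lognM ?absz_gt0 ?numq_eq0 ?denq_eq0// => h.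
by apply/eqP; rewrite subr_eq addrAC eq_sym subr_eq -!PoszD addnC h addnC.
Qed.

Lemma ratnormM : {morph ratnorm : a b / a * b}.
Proof.
move=> a b.
have [->|a0] := eqVneq a 0; first by rewrite mul0r ratnorm0 mul0r.
have [->|b0] := eqVneq b 0; first by rewrite mulr0 ratnorm0 mulr0.
rewrite -[a in LHS]divq_num_den -[b in LHS]divq_num_den mulf_div -!intrM.
rewrite ratnorm_frac ?mulf_neq0 ?numq_eq0 ?denq_eq0//.
rewrite !abszM !lognM ?absz_gt0 ?numq_eq0 ?denq_eq0//.
rewrite /ratnorm (negbTE a0) (negbTE b0).
have [p0|p0] := posnP p.
  by rewrite !(lognp0 p0) !addn0 subrr !expr0z mulr1.
rewrite -expfzDr ?pnatr_eq0 -?lt0n//; congr (_ ^ _).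
by rewrite !PoszD opprD addrACA.
Qed.

Lemma ratnorm1 : ratnorm 1 = 1.
Proof.
by rewrite /ratnorm oner_eq0 -[1 : rat]/(1%:~R : rat) numq_int denq_int subrr.
Qed.

Lemma ratnormN a : ratnorm (- a) = ratnorm a.
Proof. by rewrite /ratnorm oppr_eq0 denqN numqN abszN. Qed.

Lemma ratnormB a b : ratnorm (a - b) = ratnorm (b - a).
Proof. by rewrite -ratnormN opprB. Qed.

Lemma ratnormV a : ratnorm a^-1 = (ratnorm a)^-1.
Proof.
have [->|a0] := eqVneq a 0; first by rewrite invr0 ratnorm0 invr0.
apply: (mulfI (x := ratnorm a)); first by rewrite ratnorm_eq0.
by rewrite -ratnormM !divff ?ratnorm_eq0// ratnorm1.
Qed.

Lemma ratnorm_ultra a b : ratnorm (a + b) <= Num.max (ratnorm a) (ratnorm b).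
Proof.
have [->|a0] := eqVneq a 0; first by rewrite add0r le_max lexx orbT.
have [->|b0] := eqVneq b 0; first by rewrite addr0 le_max lexx.
have [->|ab0] := eqVneq (a + b) 0.
  by rewrite ratnorm0 le_max ratnorm_ge0.
have [pp|npp] := boolP (prime p); last first.
  have l0 n : logn p n = 0%N by rewrite /logn (negbTE npp).
  by rewrite /ratnorm (negbTE a0) (negbTE b0) (negbTE ab0) !l0 subrr
    !expr0z le_max lexx.
set d := denq a * denq b; set x := numq a * denq b; set y := numq b * denq a.
have d0 : d != 0 by rewrite mulf_neq0 ?denq_eq0.
have x0 : x != 0 by rewrite mulf_neq0 ?denq_eq0 ?numq_eq0.
have y0 : y != 0 by rewrite mulf_neq0 ?denq_eq0 ?numq_eq0.
have dr0 : (d%:~R : rat) != 0 by rewrite intr_eq0.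
have ea : a = x%:~R / d%:~R.
  rewrite -[LHS]divq_num_den; apply/eqP.
  by rewrite eqr_div ?intr_eq0 ?denq_eq0// -!intrM eqr_int /x /d -mulrA
    [denq b * _]mulrC.
have eb : b = y%:~R / d%:~R.
  rewrite -[LHS]divq_num_den; apply/eqP.
  by rewrite eqr_div ?intr_eq0 ?denq_eq0// -!intrM eqr_int /y /d -mulrA.
have eab : a + b = (x + y)%:~R / d%:~R by rewrite ea eb -mulrDl -intrD.
have xy0 : x + y != 0.
  by apply: contra_neq ab0; rewrite eab => ->; rewrite mul0r.
rewrite eab ea eb !ratnorm_frac//.
have p1 : 1 <= p%:R :> R by rewrite ler1n prime_gt0.
set k := minn (logn p `|x|) (logn p `|y|).
have kxy : (k <= logn p `|(x + y)%R|)%N.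
  rewrite -pfactor_dvdn ?absz_gt0//.
  have : ((p ^ k)%:Z %| x + y)%Z.
    rewrite rpredD// dvdzE/= pfactor_dvdn ?absz_gt0//.
      exact: geq_minl.
    exact: geq_minr.
  by rewrite dvdzE.
rewrite le_max; apply/orP; move: kxy; rewrite /k.
have [_|_] := leqP (logn p `|x|) (logn p `|y|) => kxy; [left|right];
  by rewrite ler_weXz2l// lerD2l lerN2 lez_nat.
Qed.

Lemma ratnorm_triangle a b : ratnorm (a + b) <= ratnorm a + ratnorm b.
Proof.
apply: le_trans (ratnorm_ultra a b) _.
by rewrite ge_max lerDl lerDr !ratnorm_ge0.
Qed.

Lemma ratnorm_dist a b : `|ratnorm a - ratnorm b| <= ratnorm (a - b).
Proof.
have h x y : ratnorm x - ratnorm y <= ratnorm (x - y).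
  by rewrite lerBlDr -[x in leLHS](subrK y) ratnorm_triangle.
by rewrite ler_norml h andbT lerNl opprB ratnormB h.
Qed.

End RatNorm.

Section CauchySequences.
Variables (R : realType) (p : nat).
Local Notation nrm := (ratnorm R p).

Definition is_cauchy : {pred nat -> rat} := fun u => `[<
  forall e : R, 0 < e -> exists N, forall m n,
    (N <= m)%N -> (N <= n)%N -> nrm (u m - u n) < e >].

Lemma cauchy_bounded u : u \in is_cauchy ->
  exists2 M : R, 0 < M & forall n, nrm (u n) <= M.
Proof.
move=> /asboolP /(_ 1 ltr01) [N HN].
exists (1 + nrm (u N) + \sum_(i < N) nrm (u i)).
  by rewrite -addrA ltr_wpDr// addr_ge0 ?ratnorm_ge0// sumr_ge0// => i _;
    rewrite ratnorm_ge0.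
move=> n; have s0 : 0 <= \sum_(i < N) nrm (u i).
  by rewrite sumr_ge0// => i _; rewrite ratnorm_ge0.
have [nN|Nn] := ltnP n N.
  rewrite (bigD1 (Ordinal nN))//= addrCA lerDl addr_ge0 ?addr_ge0 ?ratnorm_ge0//.
  by rewrite sumr_ge0// => i _; rewrite ratnorm_ge0.
rewrite ler_wpDr//; rewrite -{1}(subrK (u N) (u n)).
by rewrite (le_trans (ratnorm_triangle _ _ _ _))// lerD2r ltW// HN.
Qed.

Lemma cauchy_subring : subring_closed is_cauchy.
Proof.
split.
- apply/asboolP => e e0; exists 0%N => m n _ _.
  by rewrite [X in ratnorm _ _ X]subrr ratnorm0.
- move=> u v /asboolP Hu /asboolP Hv; apply/asboolP => e e0.
  have [N HN] := Hu _ e0; have [M HM] := Hv _ e0.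
  exists (maxn N M) => m n; rewrite !geq_max => /andP[Nm Mm] /andP[Nn Mn].
  have -> : (u - v) m - (u - v) n = (u m - u n) + - (v m - v n).
    by change ((u m - v m) - (u n - v n) = u m - u n - (v m - v n)); ring.
  rewrite (le_lt_trans (ratnorm_ultra _ _ _ _))// gt_max ratnormN.
  by rewrite HN// HM.
- move=> u v cu cv; have [A A0 HA] := cauchy_bounded cu.
  have [B B0 HB] := cauchy_bounded cv.
  move: cu cv => /asboolP Hu /asboolP Hv; apply/asboolP => e e0.
  have [N HN] := Hu (e / B) (divr_gt0 e0 B0).
  have [M HM] := Hv (e / A) (divr_gt0 e0 A0).
  exists (maxn N M) => m n; rewrite !geq_max => /andP[Nm Mm] /andP[Nn Mn].
  have -> : (u * v) m - (u * v) n = (u m - u n) * v m + u n * (v m - v n).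
    by change (u m * v m - u n * v n = (u m - u n) * v m + u n * (v m - v n));
      ring.
  rewrite (le_lt_trans (ratnorm_ultra _ _ _ _))// gt_max !ratnormM.
  apply/andP; split.
    rewrite (@le_lt_trans _ _ (nrm (u m - u n) * B))//.
      by rewrite ler_wpM2l ?ratnorm_ge0.
    by rewrite -ltr_pdivlMr// HN.
  rewrite (@le_lt_trans _ _ (A * nrm (v m - v n)))//.
    by rewrite ler_wpM2r ?ratnorm_ge0.
  by rewrite mulrC -ltr_pdivlMr// HM.
Qed.

HB.instance Definition _ :=
  GRing.isSubringClosed.Build (nat -> rat) is_cauchy cauchy_subring.

Record cauchy_seq := CauchySeq {
  cauchy_fun :> nat -> rat ; _ : cauchy_fun \in is_cauchy }.

HB.instance Definition _ := [isSub for cauchy_fun].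
HB.instance Definition _ := [Choice of cauchy_seq by <:].
HB.instance Definition _ := [SubChoice_isSubComNzRing of cauchy_seq by <:].

Definition is_null : {pred cauchy_seq} := fun u => `[<
  forall e : R, 0 < e -> exists N, forall n, (N <= n)%N -> nrm (u n) < e >].

Lemma null_ideal : idealr_closed is_null.
Proof.
split.
- by apply/asboolP => e e0; exists 0%N => n _; rewrite /= ratnorm0.
- apply/asboolP => /(_ 1 ltr01) [N /(_ N (leqnn N))].
  by rewrite /= ratnorm1 ltxx.
- move=> a u v /asboolP Hu /asboolP Hv; apply/asboolP => e e0.
  have [A A0 HA] := cauchy_bounded (valP a).
  have [N HN] := Hu (e / A) (divr_gt0 e0 A0).
  have [M HM] := Hv _ e0.
  exists (maxn N M) => n; rewrite !geq_max => /andP[Nn Mn].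
  rewrite (le_lt_trans (ratnorm_ultra _ _ (a n * u n) _))// gt_max HM// andbT.
  rewrite ratnormM (@le_lt_trans _ _ (A * nrm (u n)))//.
    by rewrite ler_wpM2r ?ratnorm_ge0// HA.
  by rewrite mulrC -ltr_pdivlMr// HN.
Qed.

HB.instance Definition _ := isIdealr.Build cauchy_seq is_null null_ideal.

Implicit Types u v : cauchy_seq.

Definition seqnorm (u : cauchy_seq) : R := lim (nrm (u n) @[n --> \oo]).

Lemma seqnorm_cvg u : nrm (u n) @[n --> \oo] --> seqnorm u.
Proof.
apply: cauchy_cvg; apply: cauchy_exP => e e0.
have /asboolP/(_ e e0)[N HN] := valP u.
exists (nrm (u N)); exists N => // n /= Nn; rewrite /ball/=.
by rewrite (le_lt_trans (ratnorm_dist _ _ _ _))// HN.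
Qed.

Lemma seqnorm_ge0 u : 0 <= seqnorm u.
Proof.
apply: (limr_ge (cvgP _ (@seqnorm_cvg u))); apply: nearW => n.
exact: ratnorm_ge0.
Qed.

Lemma seqnorm_null u : (seqnorm u == 0) = (u \in is_null).
Proof.
apply/eqP/asboolP => [u0 e e0|Hu].
  have := @seqnorm_cvg u; rewrite u0 => /cvgrPdist_lt /(_ e e0)[N _ HN].
  exists N => n Nn; have := HN n Nn.
  by rewrite /= sub0r normrN ger0_norm// ratnorm_ge0.
apply: cvg_lim => //; apply/cvgrPdist_lt => e e0; have [N HN] := Hu e e0.
by exists N => // n /= Nn; rewrite sub0r normrN ger0_norm ?ratnorm_ge0// HN.
Qed.

Lemma seqnormD u v : seqnorm (u + v) <= seqnorm u + seqnorm v.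
Proof.
apply: (ler_cvg_to (@seqnorm_cvg (u + v))
  (cvgD (@seqnorm_cvg u) (@seqnorm_cvg v))).
by apply: nearW => n; exact: ratnorm_triangle.
Qed.

Lemma seqnormN u : seqnorm (- u) = seqnorm u.
Proof.
rewrite /seqnorm; have -> : (fun n => nrm ((- u) n)) = (fun n => nrm (u n)).
  by apply/funext => n; exact: ratnormN.
by [].
Qed.

Lemma seqnorm_dist u v : `|seqnorm u - seqnorm v| <= seqnorm (u - v).
Proof.
have h x y : seqnorm x - seqnorm y <= seqnorm (x - y).
  by rewrite lerBlDr -[x in leLHS](subrK y) seqnormD.
by rewrite ler_norml h andbT lerNl opprB -[leRHS]seqnormN opprB h.
Qed.

Definition inv_fun (u : cauchy_seq) : nat -> rat := fun n => (u n)^-1.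

Lemma inv_fun_cauchy u : u \notin is_null -> inv_fun u \in is_cauchy.
Proof.
rewrite -seqnorm_null => u0.
have {}u0 : 0 < seqnorm u by rewrite lt_def u0 seqnorm_ge0.
have [K _ HK] := cvgr_gt _ (@seqnorm_cvg u) _ (midf_lt u0).2.
rewrite add0r in HK; set c := seqnorm u / 2 in HK.
have c0 : 0 < c by rewrite divr_gt0.
have /asboolP Hu := valP u; apply/asboolP => e e0.
have [N HN] := Hu (e * (c * c)) (mulr_gt0 e0 (mulr_gt0 c0 c0)).
exists (maxn N K) => m n; rewrite !geq_max => /andP[Nm Km] /andP[Nn Kn].
have [um un] := (HK _ Km, HK _ Kn).
have nz k : c < nrm (u k) -> u k != 0.
  by apply: contraTneq => ->; rewrite ratnorm0 -leNgt ltW.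
have -> : inv_fun u m - inv_fun u n = (u n - u m) * ((u m)^-1 * (u n)^-1).
  by rewrite /inv_fun; field; rewrite !nz.
rewrite !ratnormM !ratnormV -invfM ltr_pdivrMr; last first.
  by rewrite mulr_gt0// (lt_trans c0).
rewrite (lt_trans (HN n m Nn Nm))// ltr_pM2l// ltr_pM// ltW//.
Qed.

End CauchySequences.

(* The field of p-adic numbers: the completion of the rationals with respect to
   the p-adic absolute value, i.e. Cauchy sequences modulo null sequences. *)
Definition padic (R : realType) (p : nat) : Type := {ideal_quot (@is_null R p)}.

Section Padic.
Variables (R : realType) (p : nat).
Local Notation K := (padic R p).
Local Notation Q := {ideal_quot (@is_null R p)}.

HB.instance Definition _ := GRing.ComNzRing.copy K Q.

Definition padic_norm (x : K) : R := seqnorm (repr (x : Q)).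

Lemma padic_norm_pi u : padic_norm (\pi_Q u) = seqnorm u.
Proof.
apply/eqP; rewrite -subr_eq0 -normr_le0 (le_trans (seqnorm_dist _ _))//.
by rewrite le_eqVlt seqnorm_null Quotient.idealrBE reprK eqxx.
Qed.

Lemma padic_normN (x : K) : padic_norm (- x) = padic_norm x.
Proof.
have -> : - x = \pi_Q (- repr (x : Q)) by rewrite rmorphN /= reprK.
by rewrite padic_norm_pi seqnormN.
Qed.

Lemma padic_normD (x y : K) : padic_norm (x + y) <= padic_norm x + padic_norm y.
Proof.
have -> : x + y = \pi_Q (repr (x : Q) + repr (y : Q)) by rewrite rmorphD /= !reprK.
by rewrite padic_norm_pi seqnormD.
Qed.

Lemma padic_norm_eq0 (x : K) : (padic_norm x == 0) = (x == 0).
Proof.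
rewrite /padic_norm seqnorm_null -[repr _]subr0 Quotient.idealrBE reprK.
by rewrite rmorph0.
Qed.

Definition padic_inv (x : K) : K :=
  if x == 0 then 0 else \pi_Q (insubd 0 (inv_fun (repr (x : Q)))).

Lemma padic_mulVf (x : K) : x != 0 -> padic_inv x * x = 1.
Proof.
move=> x0; rewrite /padic_inv (negbTE x0); set u := repr (x : Q).
have u0 : u \notin @is_null R p by rewrite -seqnorm_null padic_norm_eq0.
have -> : x = \pi_Q u by rewrite reprK.
rewrite -rmorphM -[RHS](rmorph1 \pi_Q); apply/eqP.
rewrite -Quotient.idealrBE; apply/asboolP => e e0.
have d0 : 0 < seqnorm u by rewrite lt_def seqnorm_null u0 seqnorm_ge0.
have [N _ HN] := cvgr_gt _ (@seqnorm_cvg _ _ u) _ d0.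
exists N => n Nn; have {}HN := HN _ Nn.
have un0 : u n != 0 by apply: contraTneq HN => ->; rewrite ratnorm0 ltxx.
have -> : (insubd 0 (inv_fun u) * u - 1) n = (u n)^-1 * u n - 1.
  have vE : val (insubd (0 : cauchy_seq R p) (inv_fun u)) = inv_fun u.
    by rewrite insubdK// inv_fun_cauchy.
  by rewrite -[(u n)^-1]/(inv_fun u n) -[in RHS]vE.
by rewrite mulVf// subrr ratnorm0.
Qed.

Lemma padic_inv0 : padic_inv 0 = 0.
Proof. by rewrite /padic_inv eqxx. Qed.

HB.instance Definition _ :=
  GRing.ComNzRing_isField.Build K padic_mulVf padic_inv0.

Definition padic_dist (x y : K) : R := padic_norm (x - y).

Lemma padic_distxx x : padic_dist x x = 0.
Proof. by apply/eqP; rewrite /padic_dist padic_norm_eq0 subrr. Qed.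

Lemma padic_dist_positivity x y : padic_dist x y = 0 -> x = y.
Proof. by move/eqP; rewrite /padic_dist padic_norm_eq0 subr_eq0 => /eqP. Qed.

Lemma padic_dist_sym x y : padic_dist x y = padic_dist y x.
Proof. by rewrite /padic_dist -padic_normN opprB. Qed.

Lemma padic_dist_triangle y x z :
  padic_dist x z <= padic_dist x y + padic_dist y z.
Proof. by rewrite /padic_dist -[x - z](subrKA y) padic_normD. Qed.

HB.instance Definition _ := isPointed.Build K 0.
HB.instance Definition _ := isMetric.Build R K
  padic_distxx padic_dist_positivity padic_dist_sym padic_dist_triangle.

Definition padic_borel : set (set K) := <<s @open K >>.

Lemma padic_borel0 : padic_borel set0.
Proof. exact: sigma_algebra0. Qed.

Lemma padic_borelC A : padic_borel A -> padic_borel (~` A).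
Proof. exact: sigma_algebraC. Qed.

Lemma padic_borel_bigcup (F : (set K)^nat) :
  (forall i, padic_borel (F i)) -> padic_borel (\bigcup_i F i).
Proof. exact: sigma_algebra_bigcup. Qed.

HB.instance Definition _ := @isMeasurable.Build default_measure_display K
  padic_borel padic_borel0 padic_borelC padic_borel_bigcup.

End Padic.

Section PadicHarmonicAnalysis.
Variables (R : realType) (p : nat).
Local Notation K := (padic R p).
Local Notation C := R[i].

(* Translation invariance and total mass 1 of the ring of integers characterize
   the normalized Haar measure among Borel measures. *)
Definition normalized_haar (mu : {measure set K -> \bar R}) : Prop :=
  (forall (x : K) (A : set K), measurable A ->
     mu [set x + y | y in A] = mu A) /\
  mu [set x | padic_norm x <= 1] = 1%E.

(* If x has p-adic expansion \sum_(i >= -k) a_i p^i, then [x] is the finite sum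
   \sum_(-k <= i < 0) a_i p^i; as the digits vary, these sums are the rationals
   m / p^k with m < p^k, and [x] is the only one at distance at most 1 of x. *)
Definition padic_frac (x : K) : rat :=
  xget 0 [set q : rat | exists k m : nat, [/\ (m < p ^ k)%N,
    q = m%:R / p%:R ^+ k & padic_norm (x - ratr q) <= 1]].

Definition padic_char (y x : K) : C :=
  let a := 2 * pi * ratr (padic_frac (x * y)) in (cos a +i* sin a)%C.

Definition cintegral (mu : {measure set K -> \bar R}) (D : set K) (f : K -> C)
    : C :=
  (\int[mu]_(x in D) complex.Re (f x) +i* \int[mu]_(x in D) complex.Im (f x))%C.

Definition fourier (rho : {measure set K -> \bar R}) (y : K) : C :=
  cintegral rho setT (fun x => padic_char y (- x)).

(* The conditionally convergent integral over the p-adic field is the limit of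
   the integrals over the annuli p^-N <= |x| <= p^N. *)
Definition padic_Gamma (mu : {measure set K -> \bar R}) (s : R) : C :=
  lim ((cintegral mu [set x | p%:R ^- N <= padic_norm x <= p%:R ^+ N]
          (fun x => padic_char 1 x * (padic_norm x `^ (s - 1))%:C%C) : C^o)
       @[N --> \oo]).

Definition has_density (mu rho : {measure set K -> \bar R}) (g : K -> R) : Prop :=
  [/\ measurable_fun setT g, forall x, 0 <= g x
    & forall A, measurable A -> rho A = (\int[mu]_(x in A) (g x)%:E)%E].

(* exp (- c t |y|^gamma) *)
Definition stable_cf (c gamma t : R) (y : K) : R :=
  expR (- (c * t * padic_norm y `^ gamma)).

Definition stable_density (mu : {measure set K -> \bar R}) (c gamma t : R)
    (x : K) : C :=
  cintegral mu setT (fun y => padic_char y x * (stable_cf c gamma t y)%:C%C).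

End PadicHarmonicAnalysis.

(* Main.v *)
From HB Require Import structures.
Require Import Defs.
From mathcomp Require Import all_boot all_order all_algebra.
From mathcomp Require Import generic_quotient ring_quotient.
From mathcomp Require Import complex ring lra zify.
From mathcomp Require Import all_classical all_reals all_analysis.
From mathcomp Require Import measurable_realfun.

Set Implicit Arguments.
Unset Strict Implicit.
Unset Printing Implicit Defensive.

Import Order.TTheory GRing.Theory Num.Theory.
Import numFieldNormedType.Exports.

Local Open Scope classical_set_scope.
Local Open Scope ring_scope.

(** For a function phi of the absolute value, the integral of chi_y(x) phi(|y|)
    over y can be computed sphere by sphere. On the ball |y| <= p^k, which is a
    compact group, the character y |-> chi(x y) is either trivial, when
    p^k |x| <= 1, and then its integral is the mass p^k of the ball, or it takes a
    value other than 1 at some point a of the ball, and then translation by a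
    shows that the integral vanishes ([cintegral_psi_ball]). Subtracting
    consecutive balls, if |x| = p^-m the sphere of radius p^k contributes
    p^k (1 - 1/p) for k <= m, the value - p^m for k = m + 1, and nothing beyond.
    Hence
      \int chi_y(x) phi(|y|) dy
        = \sum_(i >= 0) phi(p^(m-i)) p^(m-i) (1 - 1/p) - phi(p^(m+1)) p^m
    whenever the integrals over annuli converge
    ([cvg_cintegral_psi_annulus]).

    For phi(r) = r^(s-1) and s > 0 this is a geometric series, with sum
    |x|^-s (1 - p^(s-1)) / (1 - p^-s); x = 1 gives the value of Gamma_p(s)
    ([padic_GammaE]), so the sum is |x|^-s Gamma_p(s) for every x. For
    phi(r) = exp(- C t r^gamma) it is the density at x
    ([stable_density_radial]). Only radii r <= p^(m+1) occur in the formula, so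
    the exponents C t r^gamma stay bounded, the Taylor polynomials of the
    exponential converge uniformly on them, and phi may be expanded term by term
    ([series_expR_expand]). The n-th term is the case s = n gamma + 1 of the
    previous computation times (- C t)^n / n!, which is the announced series.

    That a continuous density g is given by the integral is Fourier inversion. By
    Fubini and the same ball integrals, the integral of chi_y(x) against the
    Fourier transform of the measure over |y| <= p^n is p^n times the mass of the
    ball of radius p^-n around x ([cintegral_fourier_ball]). As n grows, one side
    tends to the full integral by dominated convergence, the other to g(x) by
    continuity ([cvg_density_ball]). *)

(** * The p-adic absolute value *)

Section PadicNorm.
Local Open Scope quotient_scope.
Variables (R : realType) (p : nat).
Local Notation K := (padic R p).
Local Notation Q := {ideal_quot (@is_null R p)}.
Local Notation nrm := (@padic_norm R p).

Lemma seqnormM (u v : cauchy_seq R p) : seqnorm (u * v) = seqnorm u * seqnorm v.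
Proof.
apply: cvg_lim => //.
have -> : (fun n => ratnorm R p ((u * v) n)) =
    (fun n => ratnorm R p (u n) * ratnorm R p (v n)).
  by apply/funext => n; rewrite -ratnormM.
by apply: cvgM; exact: seqnorm_cvg.
Qed.

Lemma seqnorm_ultra (u v : cauchy_seq R p) :
  seqnorm (u + v) <= Num.max (seqnorm u) (seqnorm v).
Proof.
apply/ler_addgt0Pr => e e0; apply: (limr_le (cvgP _ (@seqnorm_cvg _ _ (u + v)))).
have lt_e (w : cauchy_seq R p) : seqnorm w < seqnorm w + e by rewrite ltrDl.
near=> n; apply: (le_trans (ratnorm_ultra _ _ _ _)).
rewrite addr_maxl ge_max !le_max; apply/andP; split; apply/orP; [left|right];
  by apply/ltW; near: n; apply: (cvgr_lt _ (@seqnorm_cvg _ _ _)).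
Unshelve. all: by end_near. Qed.

Lemma padic_normM (x y : K) : nrm (x * y) = nrm x * nrm y.
Proof.
have -> : x * y = \pi_Q (repr (x : Q) * repr (y : Q)) by rewrite rmorphM /= !reprK.
by rewrite padic_norm_pi seqnormM.
Qed.

Lemma padic_norm_ultra (x y : K) : nrm (x + y) <= Num.max (nrm x) (nrm y).
Proof.
have -> : x + y = \pi_Q (repr (x : Q) + repr (y : Q)) by rewrite rmorphD /= !reprK.
by rewrite padic_norm_pi seqnorm_ultra.
Qed.

Lemma padic_norm_ge0 (x : K) : 0 <= nrm x.
Proof. exact: seqnorm_ge0. Qed.

Lemma padic_norm0 : nrm 0 = 0.
Proof. by apply/eqP; rewrite padic_norm_eq0. Qed.

Lemma padic_norm1 : nrm 1 = 1.
Proof.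
have : nrm 1 * nrm 1 = nrm 1 * 1 by rewrite -padic_normM !mulr1.
by apply: mulfI; rewrite padic_norm_eq0 oner_eq0.
Qed.

Lemma padic_normV (x : K) : nrm x^-1 = (nrm x)^-1.
Proof.
have [->|x0] := eqVneq x 0; first by rewrite invr0 padic_norm0 invr0.
apply: (mulfI (x := nrm x)); first by rewrite padic_norm_eq0.
by rewrite -padic_normM !divff ?padic_norm_eq0// padic_norm1.
Qed.

Lemma padic_normBC (x y : K) : nrm (x - y) = nrm (y - x).
Proof. by rewrite -padic_normN opprB. Qed.

Lemma padic_norm_gt0 (x : K) : (0 < nrm x) = (x != 0).
Proof. by rewrite lt_def padic_norm_ge0 andbT padic_norm_eq0. Qed.

Lemma padic_norm_le (x y : K) r : nrm x <= r -> nrm y <= r -> nrm (x + y) <= r.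
Proof.
by move=> xr yr; rewrite (le_trans (padic_norm_ultra _ _))// ge_max xr yr.
Qed.

Lemma padic_normB_le (x y : K) r : nrm x <= r -> nrm y <= r -> nrm (x - y) <= r.
Proof. by move=> xr yr; rewrite padic_norm_le// padic_normN. Qed.

Lemma padic_normB_trans (z x y : K) r :
  nrm (x - z) <= r -> nrm (z - y) <= r -> nrm (x - y) <= r.
Proof. by move=> xz zy; rewrite -[x - y](subrKA z) padic_norm_le. Qed.

(** All triangles are isosceles: a perturbation smaller than x does not change
    the size of x. *)
Lemma padic_norm_isosceles (x y : K) : nrm (x - y) < nrm x -> nrm y = nrm x.
Proof.
move=> xy; apply/le_anti/andP; split.
  rewrite -[y in leLHS](subKr x) padic_normB_le//; exact: ltW.
rewrite leNgt; apply/negP => yx.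
have := padic_norm_ultra (x - y) y; rewrite subrK le_max.
by rewrite !leNgt xy yx.
Qed.

Lemma const_seq_cauchy (q : rat) : (fun=> q) \in @is_cauchy R p.
Proof.
by apply/asboolP => e e0; exists 0%N => m n _ _; rewrite subrr ratnorm0.
Qed.

Definition const_seq (q : rat) : cauchy_seq R p := CauchySeq (const_seq_cauchy q).

(** Through constant sequences the embedding of the rationals is visibly a ring
    morphism; it coincides with [ratr]. *)
Definition padic_of_rat (q : rat) : K := \pi_Q (const_seq q).

Lemma padic_of_rat_is_zmod_morphism : zmod_morphism padic_of_rat.
Proof.
move=> a b; rewrite /padic_of_rat -[RHS]rmorphB.
by congr (\pi_Q _); apply: val_inj.
Qed.

Lemma padic_of_rat_is_monoid_morphism : monoid_morphism padic_of_rat.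
Proof.
split=> [|a b]; first by rewrite /padic_of_rat -[RHS](rmorph1 \pi_Q);
  congr (\pi_Q _); apply: val_inj.
rewrite /padic_of_rat -[RHS]rmorphM.
by congr (\pi_Q _); apply: val_inj.
Qed.

HB.instance Definition _ :=
  GRing.isZmodMorphism.Build rat K padic_of_rat padic_of_rat_is_zmod_morphism.
HB.instance Definition _ :=
  GRing.isMonoidMorphism.Build rat K padic_of_rat padic_of_rat_is_monoid_morphism.

Lemma padic_of_ratE (q : rat) : padic_of_rat q = ratr q.
Proof. exact: fmorph_eq_rat. Qed.

Lemma ratrB_padic (a b : rat) : ratr (a - b) = ratr a - ratr b :> K.
Proof. by rewrite -!padic_of_ratE rmorphB. Qed.

Lemma ratrD_padic (a b : rat) : ratr (a + b) = ratr a + ratr b :> K.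
Proof. by rewrite -!padic_of_ratE rmorphD. Qed.

Lemma ratrM_padic (a b : rat) : ratr (a * b) = ratr a * ratr b :> K.
Proof. by rewrite -!padic_of_ratE rmorphM. Qed.

Lemma padic_norm_ratr (q : rat) : nrm (ratr q) = ratnorm R p q.
Proof.
rewrite -padic_of_ratE padic_norm_pi; rewrite /seqnorm.
by apply: cvg_lim => //; exact: (@cvg_cst _ (ratnorm R p q)). Qed.

Lemma padic_rat_dense (x : K) (e : R) : 0 < e -> exists q : rat, nrm (x - ratr q) < e.
Proof.
move=> e0; set u := repr (x : Q).
have /asboolP/(_ (e / 2))[|N HN] := valP u; first by rewrite divr_gt0.
exists (u N); rewrite -padic_of_ratE.
have -> : x - padic_of_rat (u N) = \pi_Q (u - const_seq (u N)).
  by rewrite rmorphB /= reprK.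
rewrite padic_norm_pi (@le_lt_trans _ _ (e / 2))//; last by lra.
apply: (limr_le (cvgP _ (@seqnorm_cvg _ _ _))).
by exists N => // n /= Nn; apply/ltW/HN.
Qed.

End PadicNorm.

Section PrimeBase.
Variables (R : realType) (p : nat) (p_prime : prime p).
Local Notation K := (padic R p).
Local Notation nrm := (@padic_norm R p).
Local Notation P := (p%:R : R).

Lemma p_gt1 : 1 < P. Proof. by rewrite ltr1n prime_gt1. Qed.
Lemma p_gt0 : 0 < P. Proof. by rewrite ltr0n prime_gt0. Qed.
Lemma p_neq0 : P != 0. Proof. by rewrite gt_eqF// p_gt0. Qed.
Lemma pz_gt0 (k : int) : 0 < P ^ k. Proof. by rewrite exprz_gt0// p_gt0. Qed.
Lemma pz_le (k l : int) : (P ^ k <= P ^ l) = (k <= l).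
Proof. by rewrite ler_eXz2l// p_gt1. Qed.
Lemma pz_lt (k l : int) : (P ^ k < P ^ l) = (k < l).
Proof. by rewrite ltr_eXz2l// p_gt1. Qed.

(** By density, every nonzero x has the same absolute value as some rational. *)
Lemma padic_norm_pz (x : K) : x != 0 -> exists k : int, nrm x = P ^ k.
Proof.
rewrite -padic_norm_gt0 => /(padic_rat_dense x)[q xq].
have := padic_norm_isosceles xq; rewrite padic_norm_ratr => <-.
move: xq (xq) => /padic_norm_isosceles; rewrite padic_norm_ratr.
rewrite /ratnorm; case: ifPn => [/eqP _ <-|]; first by rewrite ltNge padic_norm_ge0.
by eexists.
Qed.

Lemma padic_norm_nat (n : nat) : nrm n%:R <= 1.
Proof.
elim: n => [|n IH]; first by rewrite padic_norm0.
by rewrite -natr1 padic_norm_le// padic_norm1.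
Qed.

Lemma padic_norm_int (n : int) : nrm n%:~R <= 1.
Proof. by case: n => n; rewrite ?NegzE ?mulrNz ?padic_normN padic_norm_nat. Qed.

Lemma padic_norm_int_le (n : int) (k : nat) :
  (nrm n%:~R <= P ^- k) = ((p ^ k)%:Z %| n)%Z.
Proof.
have [->|n0] := eqVneq n 0.
  by rewrite padic_norm0 invr_ge0 exprn_ge0 ?ltW ?p_gt0// dvdz0.
rewrite -ratr_int padic_norm_ratr.
have := @ratnorm_frac R p n 1 n0 isT.
rewrite divr1 => ->; rewrite logn1 sub0r exprnN pz_le lerN2 lez_nat.
by rewrite dvdzE /= pfactor_dvdn ?absz_gt0.
Qed.

Lemma padic_norm_pX (k : nat) : nrm (p%:R ^+ k) = P ^- k.
Proof.
elim: k => [|k IH]; first by rewrite padic_norm1 invr1.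
rewrite !exprS padic_normM IH invfM; congr (_ * _).
have := @ratnorm_frac R p p 1; rewrite divr1 -padic_norm_ratr ratr_int => -> //.
  by rewrite logn1 logn_prime// eqxx.
by rewrite -lt0n prime_gt0.
Qed.

Lemma padicp_neq0 : p%:R != 0 :> K.
Proof. by rewrite -padic_norm_gt0 -[p%:R]expr1 padic_norm_pX invr_gt0 expr1 p_gt0. Qed.

Lemma padic_norm_pXz (k : int) : nrm (p%:R ^ k) = P ^ (- k).
Proof.
case: k => k; first by rewrite padic_norm_pX -exprnN.
by rewrite NegzE -exprnN padic_normV padic_norm_pX opprK invrK.
Qed.

(** The unit ball modulo p^k consists of the p^k classes of natural numbers: a
    rational a / b close to z has b prime to p, and a times an inverse of b modulo
    p^k is the required representative. *)
Lemma padic_int_approx (z : K) (k : nat) : nrm z <= 1 ->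
  exists2 m : nat, (m < p ^ k)%N & nrm (z - m%:R) <= P ^- k.
Proof.
move=> z1; have pk0 : 0 < P ^- k by rewrite invr_gt0 exprn_gt0// p_gt0.
have pk1 : P ^- k <= 1 by rewrite invf_le1 ?exprn_gt0 ?p_gt0// exprn_ege1// ltW// p_gt1.
have [q zq] := padic_rat_dense z pk0.
have q1 : nrm (ratr q) <= 1.
  rewrite -[ratr q](subKr z) padic_normB_le//.
  by rewrite (le_trans (ltW zq)).
have pkN0 : (p ^ k)%N != 0%N by rewrite expn_eq0 negb_and -lt0n prime_gt0.
(* a factor p in the denominator would make the absolute value exceed 1 *)
have nd : ~~ ((p%:Z) %| denq q)%Z.
  have [->|q0] := eqVneq q 0; first by rewrite dvdzE/= dvdn1 neq_ltn prime_gt1 ?orbT.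
  apply/negP => pd; move: q1; rewrite padic_norm_ratr /ratnorm (negbTE q0).
  rewrite -[X in _ <= X](expr0z P) pz_le subr_le0 lez_nat.
  have := coprime_num_den q; move: pd; rewrite dvdzE /= => pd.
  have : (0 < logn p `|denq q|)%N by rewrite logn_gt0 mem_primes p_prime absz_gt0 denq_eq0 pd.
  move=> h1 cop h2; have : (0 < logn p `|numq q|)%N by exact: leq_trans h2.
  rewrite logn_gt0 mem_primes => /and3P[_ _ pn].
  have : (p %| gcdn `|numq q| `|denq q|)%N by rewrite dvdn_gcd pn.
  by rewrite (eqP cop) dvdn1 => /eqP pe; have := prime_gt1 p_prime; rewrite pe.
have [u [v uv]] : exists u v : int, u * (p ^ k)%:Z + v * denq q = 1.
  have cop : coprimez (p ^ k)%:Z (denq q).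
    have : coprime (p ^ k) `|denq q| by rewrite coprimeXl// prime_coprime.
    by rewrite coprimezE.
  have [[u v] /= h] := coprimezP _ _ cop.
  by exists u, v.
have dq : ratr q = (numq q)%:~R / (denq q)%:~R :> K by [].
have den0 : (denq q)%:~R != 0 :> K.
  by rewrite -ratr_int -padic_norm_gt0 padic_norm_ratr ratnorm_gt0// intr_eq0 denq_eq0.
(* v inverts the denominator modulo p^k *)
pose m := ((numq q * v) %% (p ^ k)%:Z)%Z.
have m0 : 0 <= m by rewrite modz_ge0.
have mlt : m < (p ^ k)%:Z by rewrite ltz_mod.
exists `|m|%N; first by rewrite -ltz_nat gez0_abs.
have -> : z - `|m|%N%:R = (z - ratr q) + (ratr q - m%:~R).
  by rewrite addrA subrK; congr (_ - _); rewrite -[m in RHS]gez0_abs.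
apply: padic_norm_le; first exact: ltW.
have -> : ratr q - m%:~R = (numq q - m * denq q)%:~R / (denq q)%:~R :> K.
  by rewrite dq intrB intrM mulrBl mulfK.
have nden : nrm (denq q)%:~R = 1.
  apply/eqP; rewrite eq_le padic_norm_int leNgt.
  have -> : (nrm (denq q)%:~R < 1) = (nrm (denq q)%:~R <= P ^- 1).
    have [j ->] := padic_norm_pz den0.
    by rewrite -(expr0z P) exprnN pz_lt pz_le; lia.
  by rewrite padic_norm_int_le expn1.
rewrite padic_normM padic_normV nden invr1 mulr1 padic_norm_int_le.
have := divz_eq (numq q * v) (p ^ k)%:Z; rewrite -/m => e.
have -> : numq q - m * denq q = (p ^ k)%:Z * (numq q * u +
   ((numq q * v) %/ (p ^ k)%:Z)%Z * denq q).
  have -> : m = numq q * v - ((numq q * v) %/ (p ^ k)%:Z)%Z * (p ^ k)%:Z.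
    by apply/eqP; rewrite eq_sym subr_eq addrC; apply/eqP.
  rewrite -{1}[numq q]mulr1 -uv; ring.
exact: dvdz_mulr.
Qed.

Lemma padic_norm_leXn (x : K) : exists k : nat, nrm x <= P ^+ k.
Proof.
have [->|/padic_norm_pz[k ->]] := eqVneq x 0.
  by exists 0%N; rewrite padic_norm0 expr0.
by exists `|k|%N; rewrite exprnP pz_le lez_abs.
Qed.

End PrimeBase.

(** * Fractional parts and the additive character *)

Section UnitCircle.
Variable R : realType.

Definition expi (a : R) : R[i] := (cos (2 * pi * a) +i* sin (2 * pi * a))%C.

Lemma expi0 : expi 0 = 1.
Proof. by rewrite /expi mulr0 cos0 sin0. Qed.

Lemma expiD (a b : R) : expi (a + b) = expi a * expi b.
Proof.
rewrite /expi mulrDr cosD sinD; apply/eqP; rewrite eq_complex /=.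
by rewrite eqxx/= addrC eqxx.
Qed.

Lemma expi1 : expi 1 = 1.
Proof. by rewrite /expi mulr1 mulrC mulr_natr cos2pi sin2pi. Qed.

Lemma expi_nat (n : nat) : expi n%:R = 1.
Proof. by elim: n => [|n IH]; rewrite ?expi0// -natr1 expiD IH expi1 mulr1. Qed.

Lemma expi_int (n : int) : expi n%:~R = 1.
Proof.
case: n => n; first exact: expi_nat.
have := expiD (- n.+1%:R) n.+1%:R.
by rewrite NegzE mulrNz addNr expi0 expi_nat mulr1 => <-.
Qed.

(** The cosine is injective on [0, pi], which settles a <= 1/2; the other half of
    the circle follows by the reflection a |-> 1 - a. *)
Lemma expi_neq1 (a : R) : 0 < a < 1 -> expi a <> 1.
Proof.
move=> /andP[a0 a1] [c1 s0].
have pi0 := pi_gt0 R.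
have [a2|a2] := lerP a (1 / 2).
  have : 2 * pi * a = 0 by apply: cos_inj; rewrite ?cos0// !in_itv/= ?lexx/= ?pi_ge0//; nra.
  by move=> /eqP; rewrite !mulf_eq0 (gt_eqF a0) (gt_eqF pi0) pnatr_eq0.
have c2 : cos (2 * pi * (1 - a)) = 1.
  by rewrite mulrBr mulr1 cosB c1 s0 [2 * pi]mulrC mulr_natr cos2pi sin2pi; lra.
have : 2 * pi * (1 - a) = 0.
  by apply: cos_inj; rewrite ?cos0// !in_itv/= ?lexx/= ?pi_ge0//; nra.
by move=> /eqP; rewrite !mulf_eq0 (gt_eqF pi0) pnatr_eq0 subr_eq0 (gt_eqF a1).
Qed.

End UnitCircle.

Section AdditiveCharacter.
Variables (R : realType) (p : nat) (p_prime : prime p).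
Local Notation K := (padic R p).
Local Notation nrm := (@padic_norm R p).
Local Notation P := (p%:R : R).

Lemma padic_fracP (x : K) : exists k m : nat, [/\ (m < p ^ k)%N,
    padic_frac x = m%:R / p%:R ^+ k & nrm (x - ratr (padic_frac x)) <= 1].
Proof.
suff [q Hq] : exists q : rat, [set q : rat | exists k m : nat, [/\ (m < p ^ k)%N,
    q = m%:R / p%:R ^+ k & nrm (x - ratr q) <= 1]] q by exact: (xgetPex 0 (ex_intro _ q Hq)).
have [k xk] := padic_norm_leXn p_prime x.
have pk0 : 0 < P ^+ k by rewrite exprn_gt0// p_gt0.
have pk : nrm (p%:R ^+ k) = P ^- k by exact: padic_norm_pX.
have [|m mlt xm] := @padic_int_approx R p p_prime (p%:R ^+ k * x) k.
  by rewrite padic_normM pk mulrC ler_pdivrMr// mul1r.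
exists (m%:R / p%:R ^+ k), k, m; split=> //.
have -> : x - ratr (m%:R / p%:R ^+ k) = (p%:R ^+ k * x - m%:R) / p%:R ^+ k.
  rewrite ratrM_padic -(natrX _ p k) -padic_of_ratE -[ratr _^-1]padic_of_ratE.
  rewrite fmorphV !rmorph_nat !natrX mulrBl mulrAC divff ?mul1r//.
  by rewrite expf_neq0// padicp_neq0.
by rewrite padic_normM padic_normV pk invrK -ler_pdivlMr// mul1r.
Qed.

(** Z[1/p] meets the ring of p-adic integers in Z. *)
Lemma padic_norm_frac_int (M : int) (k : nat) :
  nrm (ratr (M%:~R / p%:R ^+ k)) <= 1 -> exists n : int, M%:~R / p%:R ^+ k = n%:~R :> rat.
Proof.
have pk0 : 0 < P ^+ k by rewrite exprn_gt0// p_gt0.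
have pr0 : p%:R ^+ k != 0 :> rat by rewrite expf_neq0// pnatr_eq0 -lt0n prime_gt0.
rewrite ratrM_padic -padic_of_ratE -[ratr _^-1]padic_of_ratE.
rewrite fmorphV rmorphXn rmorph_nat rmorph_int padic_normM padic_normV padic_norm_pX// invrK.
rewrite -ler_pdivlMr// mul1r padic_norm_int_le// => /dvdzP[n ->].
by exists n; rewrite intrM -[((p ^ k)%:Z)%:~R]/((p ^ k)%:R) natrX mulfK.
Qed.

(** Two approximations from Z[1/p] of the same x differ by an element of Z[1/p] of
    absolute value at most 1, hence by an integer. This frees computations with the
    character from the particular representative of the fractional part. *)
Lemma padic_frac_modZ (x : K) (M : int) (k : nat) :
  nrm (x - ratr (M%:~R / p%:R ^+ k)) <= 1 ->
  exists n : int, padic_frac x = M%:~R / p%:R ^+ k + n%:~R.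
Proof.
move=> h; have [l [m [_ fE fx]]] := padic_fracP x.
have pr0 : p%:R != 0 :> rat by rewrite pnatr_eq0 -lt0n prime_gt0.
have dE : padic_frac x - M%:~R / p%:R ^+ k =
   (m%:Z * (p ^ k)%:Z - M * (p ^ l)%:Z)%:~R / p%:R ^+ (l + k).
  rewrite fE exprD rmorphB !rmorphM /= -!pmulrn !natrX.
  by field; rewrite !expf_neq0.
have : nrm (ratr (padic_frac x - M%:~R / p%:R ^+ k)) <= 1.
  rewrite ratrB_padic; set a := ratr _ in fx *; set b := ratr _ in h *.
  have -> : a - b = (x - b) - (x - a) by ring.
  exact: padic_normB_le.
rewrite dE => /padic_norm_frac_int[n nE]; exists n.
by rewrite -nE -dE addrC subrK.
Qed.

(** The standard character chi_1; all the others are y |-> padic_psi (x * y). *)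
Definition padic_psi (x : K) : R[i] := expi (ratr (padic_frac x)).

Lemma padic_charE (y x : K) : padic_char y x = padic_psi (x * y).
Proof. by []. Qed.

Lemma padic_psiE (x : K) (M : int) (k : nat) :
  nrm (x - ratr (M%:~R / p%:R ^+ k)) <= 1 ->
  padic_psi x = expi (ratr (M%:~R / p%:R ^+ k)).
Proof.
move=> /padic_frac_modZ[n ne].
by rewrite /padic_psi ne rmorphD /= ratr_int expiD expi_int mulr1.
Qed.

Lemma padic_psiD (x y : K) : padic_psi (x + y) = padic_psi x * padic_psi y.
Proof.
have [k [m [_ fx hx]]] := padic_fracP x.
have [l [n [_ fy hy]]] := padic_fracP y.
have pr0 : p%:R != 0 :> rat by rewrite pnatr_eq0 -lt0n prime_gt0.
rewrite {2 3}/padic_psi -expiD -rmorphD /=.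
have sE : padic_frac x + padic_frac y =
   (m%:Z * (p ^ l)%:Z + n%:Z * (p ^ k)%:Z)%:~R / p%:R ^+ (k + l).
  rewrite fx fy exprD rmorphD !rmorphM /= -!pmulrn !natrX.
  by field; rewrite !expf_neq0.
rewrite sE; apply: padic_psiE; rewrite -sE ratrD_padic.
have -> (a b c d : K) : a + b - (c + d) = (a - c) + (b - d) by ring.
exact: (padic_norm_le hx hy).
Qed.

Lemma padic_psi1 (x : K) : nrm x <= 1 -> padic_psi x = 1.
Proof.
move=> x1; have z0 : 0%:~R / p%:R ^+ 0 = 0 :> rat by rewrite mul0r.
rewrite (@padic_psiE x 0 0) z0; first by rewrite rmorph0 expi0.
by rewrite -padic_of_ratE rmorph0 subr0.
Qed.

Lemma padic_psi_pV : padic_psi p%:R^-1 <> 1.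
Proof.
rewrite (@padic_psiE _ 1 1) expr1.
  apply: expi_neq1; rewrite mul1r fmorphV rmorph_nat.
  by rewrite invr_gt0 p_gt0//= invf_lt1 ?p_gt1 ?p_gt0.
by rewrite mul1r -padic_of_ratE fmorphV rmorph_nat subrr padic_norm0.
Qed.

Lemma padic_psi_locconst (x y : K) : nrm (x - y) <= 1 -> padic_psi x = padic_psi y.
Proof. by move=> xy; rewrite -[x](subrK y) padic_psiD padic_psi1// mul1r. Qed.

Lemma norm_Re_padic_psi (x : K) : `|complex.Re (padic_psi x)| <= 1.
Proof. by rewrite ler_norml cos_geN1 cos_le1. Qed.

Lemma norm_Im_padic_psi (x : K) : `|complex.Im (padic_psi x)| <= 1.
Proof. by rewrite ler_norml sin_geN1 sin_le1. Qed.

End AdditiveCharacter.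

(** * Borel sets and Haar measure *)

Section PadicBorel.
Variables (R : realType) (p : nat) (p_prime : prime p).
Local Notation K := (padic R p).
Local Notation nrm := (@padic_norm R p).
Local Notation P := (p%:R : R).

Lemma pXN_lt (e : R) : 0 < e -> exists N : nat, P ^- N < e.
Proof.
move=> e0; have /cvgrPdist_lt /(_ e e0)[N _ HN] : P^-1 ^+ n @[n --> \oo] --> (0 : R).
  by apply: cvg_expr; rewrite ger0_norm ?invr_ge0 ?invf_lt1 ?p_gt1 ?p_gt0.
exists N; have := HN N (leqnn N).
by rewrite sub0r normrN exprVn ger0_norm// invr_ge0 exprn_ge0// ltW// p_gt0.
Qed.

Definition padic_ball (a : K) (k : int) : set K := [set x | nrm (x - a) <= P ^ k].

Lemma nbhs_padicP (x : K) (A : set K) :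
  nbhs x A <-> exists n : nat, padic_ball x (- n%:Z) `<=` A.
Proof.
split=> [/nbhs_ballP[e /= e0 eA]|[n nA]].
  have [N HN] := pXN_lt e0.
  exists N => y xy; apply: eA; rewrite ballEmdist /=.
  rewrite /mdist /= /padic_dist padic_normBC; apply: le_lt_trans HN.
  by rewrite exprnN.
apply/nbhs_ballP; exists (P ^ (- n%:Z)) => /=; first exact: pz_gt0.
move=> y; rewrite ballEmdist /= => xy; apply: nA.
by rewrite /padic_ball /= padic_normBC ltW.
Qed.

(** Preimages under a locally constant function are open, whatever the target set,
    so that no structure on the codomain is involved. *)
Lemma measurable_locconst_preim T (f : K -> T) (D : set K) (Y : set T) :
  (forall x, D x -> exists n : nat, forall y, nrm (y - x) <= P ^ (- n%:Z) ->
    D y /\ f y = f x) -> measurable (D `&` f @^-1` Y).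
Proof.
move=> fD; apply: sub_sigma_algebra; rewrite openE => x [Dx fx].
have [n Hn] := fD x Dx; apply/nbhs_padicP; exists n => y /Hn[Dy fy].
by split=> //=; rewrite fy.
Qed.

Lemma measurable_padic_ball a k : measurable (padic_ball a k).
Proof.
rewrite -[padic_ball a k]setIT -(preimage_setT (fun _ : K => tt)).
apply: measurable_locconst_preim => x xa; exists `|k|%N => y yx; split=> //.
apply: (@padic_normB_trans _ _ x) => //.
by rewrite (le_trans yx)// pz_le//; lia.
Qed.

Lemma measurable_padic_set1 (a : K) : measurable [set a].
Proof.
have -> : [set a] = \bigcap_n padic_ball a (- n%:Z).
  apply/seteqP; split=> [_ -> n _|x xa].
    by rewrite /padic_ball /= subrr padic_norm0 ltW// pz_gt0.
  apply: contrapT => /eqP; rewrite -subr_eq0 -padic_norm_gt0 => x0.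
  have /nbhs_padicP[n Hn] : nbhs a [set y | nrm (y - a) < nrm (x - a)].
    apply/nbhs_ballP; exists (nrm (x - a)) => //= y.
    by rewrite ballEmdist /= /mdist /= /padic_dist padic_normBC.
  by have := Hn x (xa n I); rewrite /= ltxx.
by apply: bigcapT_measurable => n; exact: measurable_padic_ball.
Qed.

(** The absolute value is locally constant away from the origin, and the origin is
    closed; in consequence every radial function is measurable. *)
Lemma measurable_padic_norm_preim (Y : set R) : measurable (nrm @^-1` Y).
Proof.
have -> : nrm @^-1` Y =
    ([set 0] `&` nrm @^-1` Y) `|` (~` [set 0] `&` nrm @^-1` Y).
  by rewrite -setIUl setUv setTI.
apply: measurableU.
  have [Y0|Y0] := pselect (Y 0).
    rewrite (_ : _ `&` _ = [set 0]); first exact: measurable_padic_set1.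
    by apply/seteqP; split=> [x []//|_ ->]; split=> //=; rewrite padic_norm0.
  rewrite (_ : _ `&` _ = set0)//; apply/seteqP; split=> // x [->] /=.
  by rewrite padic_norm0.
apply: measurable_locconst_preim => x /= /eqP x0.
have [k xk] := padic_norm_pz x0; exists (`|k|%N).+1 => y yx.
have xy : nrm y = nrm x.
  apply: padic_norm_isosceles; rewrite padic_normBC (le_lt_trans yx)// xk pz_lt//.
  lia.
by split=> // y0; move: x0; rewrite -padic_norm_eq0 -xy y0 padic_norm0 eqxx.
Qed.

Lemma measurable_radial d (T : sigmaRingType d) (phi : R -> T) :
  measurable_fun setT (fun x : K => phi (nrm x)).
Proof.
by move=> _ Y mY; rewrite setTI; exact: (measurable_padic_norm_preim (phi @^-1` Y)).
Qed.

Lemma measurable_locconst d (T : sigmaRingType d) (f : K -> T) :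
  (forall x, exists n : nat, forall y, nrm (y - x) <= P ^ (- n%:Z) -> f y = f x) ->
  measurable_fun setT f.
Proof.
move=> fl _ Y mY; apply: measurable_locconst_preim => x _.
by have [n Hn] := fl x; exists n => y /Hn.
Qed.

(** Fubini needs measurability for the product sigma-algebra, not for the Borel sets
    of the product space. Rationals being dense, a preimage is the union of the
    countably many products of balls with rational centres that it contains. *)
Lemma measurable_locconst2 d (T : sigmaRingType d) (f : K * K -> T) :
  (forall x, exists n : nat, forall y, nrm (y.1 - x.1) <= P ^ (- n%:Z) ->
     nrm (y.2 - x.2) <= P ^ (- n%:Z) -> f y = f x) ->
  measurable_fun setT f.
Proof.
move=> fl _ Y _; rewrite setTI.
pose B (u : rat * rat * nat) := padic_ball (ratr u.1.1) (- u.2%:Z) `*`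
  padic_ball (ratr u.1.2) (- u.2%:Z).
pose F (u : rat * rat * nat) := if `[< B u `<=` f @^-1` Y >] then B u else set0.
have -> : f @^-1` Y = \bigcup_u F u.
  apply/seteqP; split=> [x Yx|x [u _]]; last first.
    by rewrite /F; case: asboolP => [+ Bx|_ []]; exact.
  have [n Hn] := fl x.
  have [q1 hq1] := padic_rat_dense x.1 (pz_gt0 R p_prime (- n%:Z)).
  have [q2 hq2] := padic_rat_dense x.2 (pz_gt0 R p_prime (- n%:Z)).
  have Bx : B (q1, q2, n) x := conj (ltW hq1) (ltW hq2).
  exists (q1, q2, n) => //; rewrite /F; case: asboolP => // -[] y [y1 y2] /=.
  have sym z (q : rat) : nrm (z - ratr q) < P ^ (- n%:Z) ->
    nrm (ratr q - z) <= P ^ (- n%:Z) by rewrite padic_normBC => /ltW.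
  rewrite (Hn y)//.
    exact: (padic_normB_trans y1 (sym _ _ hq1)).
  exact: (padic_normB_trans y2 (sym _ _ hq2)).
apply: countable_bigcupT_measurable => // u; rewrite /F; case: asboolP => // _.
by apply: measurableX; exact: measurable_padic_ball.
Qed.

Lemma measurable_translate (a : K) : measurable_fun setT (fun x : K => x + a).
Proof.
apply: (measurability (@open K)) => //.
move=> _ [U oU <-]; apply: sub_sigma_algebra; rewrite setTI openE => x Ux.
move: oU; rewrite openE => /(_ _ Ux) /nbhs_padicP[n Hn].
apply/nbhs_padicP; exists n => y yx; apply: Hn.
by rewrite /padic_ball /= opprD addrACA subrr addr0.
Qed.

End PadicBorel.

Section Haar.
Variables (R : realType) (p : nat) (p_prime : prime p).
Local Notation K := (padic R p).
Local Notation nrm := (@padic_norm R p).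
Local Notation P := (p%:R : R).
Local Notation ball := (@padic_ball R p).
Variables (mu : {measure set K -> \bar R}) (mu_haar : normalized_haar mu).

(** Preimages are the form in which invariance meets push-forward measures. *)
Lemma haar_translate (a : K) (A : set K) : measurable A ->
  mu ((fun x => x + a) @^-1` A) = mu A.
Proof.
move=> mA; rewrite -[RHS](mu_haar.1 (- a) A mA).
congr (mu _); apply/seteqP; split=> [x Ax|_ [y Ay <-]].
  by exists (x + a) => //; rewrite addrC addrK.
by rewrite /= addrC addNKr.
Qed.

Lemma haar_ball_center (a : K) (k : int) : mu (ball a k) = mu (ball 0 k).
Proof.
rewrite -(haar_translate (- a) (measurable_padic_ball p_prime 0 k)).
by congr (mu _); apply/seteqP; split=> x /=; rewrite /padic_ball /= subr0.
Qed.

(** A ball is the disjoint union of p balls of the next smaller radius, since the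
    residue field has p elements. *)
Lemma haar_ball_step (k : int) : mu (ball 0 (k + 1)) = (P%:E * mu (ball 0%R k))%E.
Proof.
(* multiplication by c maps the unit ball onto the ball of radius p^(k+1) *)
pose c : K := p%:R ^ (- (k + 1)).
have nc : nrm c = P ^ (k + 1) by rewrite padic_norm_pXz// opprK.
have c0 : c != 0 by rewrite -padic_norm_gt0 nc pz_gt0.
have PE : P ^ (k + 1) = P * P ^ k by rewrite expfzDr ?p_neq0// expr1z mulrC.
pose F (m : nat) := ball (m%:R * c) k.
have E : ball 0 (k + 1) = \big[setU/set0]_(m < p) F m.
  apply/seteqP; split=> [x|x].
    rewrite /padic_ball /= subr0 => xk.
    have [|m mp xm] := @padic_int_approx R p p_prime (x / c) 1.
      by rewrite padic_normM padic_normV nc ler_pdivrMr ?mul1r ?pz_gt0.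
    rewrite expn1 in mp; rewrite -bigcup_mkord; exists m => //=.
    rewrite /F /padic_ball /= -[x](divfK c0) -mulrBl padic_normM nc PE mulrA.
    rewrite ler_piMl ?(ltW (pz_gt0 _ _ _))// -ler_pdivlMr ?p_gt0// mul1r.
    by rewrite expr1 in xm.
  rewrite -bigcup_mkord => -[m /= _]; rewrite /F /padic_ball /= subr0 => xm.
  rewrite -[x](subrK (m%:R * c)) padic_norm_le//.
    by rewrite (le_trans xm)// pz_le//; lia.
  by rewrite padic_normM nc ler_piMl ?padic_norm_nat ?ltW ?pz_gt0.
rewrite E measure_bigsetU_ord; first last.
- move=> i j _ _ [x [xi xj]]; apply/val_inj/eqP.
  wlog ij : i j xi xj / (j <= i)%N.
    by move=> W; case/orP: (leq_total j i) => h; [|rewrite eq_sym]; exact: W h.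
  have : nrm ((i - j)%N%:Z%:~R) <= P ^- 1.
    have h : nrm ((i%:R - j%:R) * c) <= P ^ k.
      rewrite mulrBl; apply: (@padic_normB_trans _ _ x) => //.
      by rewrite padic_normBC.
    rewrite padic_normM nc PE mulrA -[leRHS]mul1r ler_pM2r ?pz_gt0// in h.
    by rewrite expr1 -[leRHS]mul1r ler_pdivlMr ?p_gt0// -pmulrn natrB.
  rewrite padic_norm_int_le// expn1 dvdzE /= => /dvdnP[[|q] hq].
    by rewrite eqn_leq ij andbT -subn_eq0 hq.
  by have := ltn_ord i; nia.
- by move=> i; exact: measurable_padic_ball.
rewrite (eq_bigr (fun=> mu (ball 0 k))); last by move=> i _; exact: haar_ball_center.
by rewrite sumr_const card_ord mule_natl.
Qed.

Lemma haar_ball (a : K) (k : int) : mu (ball a k) = (P ^ k)%:E.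
Proof.
have PE (j : int) : P ^ (j + 1) = P * P ^ j by rewrite expfzDr ?p_neq0// expr1z mulrC.
rewrite haar_ball_center; elim/int_rec: k => [|n IH|n IH].
- rewrite expr0z -[RHS]mu_haar.2; congr (mu _).
  by apply/seteqP; split=> x; rewrite /padic_ball /= subr0 expr0z.
- by rewrite -addn1 PoszD haar_ball_step IH PE.
- have := haar_ball_step (- n.+1%:Z); have -> : - n.+1%:Z + 1 = - n%:Z by lia.
  rewrite IH; have -> : - n%:Z = - n.+1%:Z + 1 by lia.
  rewrite PE; case: (mu _) => [r| |].
  + by rewrite -EFinM => -[] /(mulfI (p_neq0 _ _)) ->.
  + by rewrite gt0_muley// lte_fin p_gt0.
  + by rewrite gt0_muleNy// lte_fin p_gt0.
Qed.

Lemma haar_set1 (a : K) : mu [set a] = 0%E.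
Proof.
apply/eqP; rewrite eq_le measure_ge0 andbT; apply/lee_addgt0Pr => e e0.
rewrite add0e.
have [N HN] := pXN_lt p_prime e0.
rewrite (@le_trans _ _ (mu (ball a (- N%:Z))))//.
  apply: le_measure; rewrite ?inE; [exact: measurable_padic_set1| exact: measurable_padic_ball|].
  by move=> _ ->; rewrite /padic_ball /= subrr padic_norm0 ltW// pz_gt0.
by rewrite haar_ball lee_fin -exprnN ltW.
Qed.

End Haar.

(** * Integrals of the character over balls, spheres and shells *)

Section ComplexIntegral.
Variables (R : realType) (p : nat) (p_prime : prime p).
Local Notation K := (padic R p).
Variable mu : {measure set K -> \bar R}.

Definition cintegrable (D : set K) (f : K -> R[i]) :=
  mu.-integrable D (EFin \o (fun x => complex.Re (f x))) /\
  mu.-integrable D (EFin \o (fun x => complex.Im (f x))).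

Lemma eq_cintegral D (f g : K -> R[i]) : (forall x, D x -> f x = g x) ->
  cintegral mu D f = cintegral mu D g.
Proof.
by move=> fg; congr (_ +i* _)%C; apply: eq_Rintegral => x /set_mem /fg ->.
Qed.

Lemma cintegralZl D (f : K -> R[i]) (z : R[i]) : measurable D -> cintegrable D f ->
  cintegral mu D (fun x => z * f x) = z * cintegral mu D f.
Proof.
move=> mD [fr fi]; case: z => a b.
have scale (c : R) (g : K -> R) : mu.-integrable D (EFin \o g) ->
    mu.-integrable D (EFin \o (fun x => c * g x)).
  by move=> ig; exact: (integrableZl mD c ig).
rewrite /cintegral; apply/eqP; rewrite eq_complex /=; apply/andP; split; apply/eqP.
  rewrite -!RintegralZl//.
  rewrite -[RHS]RintegralB//; [|exact: scale..].
  by apply: eq_Rintegral => x _; case: (f x).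
rewrite -!RintegralZl//.
rewrite -[RHS]RintegralD//; [|exact: scale..].
by apply: eq_Rintegral => x _; case: (f x).
Qed.

Lemma cintegral_setU A B (f : K -> R[i]) : measurable A -> measurable B ->
  cintegrable (A `|` B) f -> [disjoint A & B] ->
  cintegral mu (A `|` B) f = cintegral mu A f + cintegral mu B f.
Proof. by move=> mA mB [fr fi] AB; rewrite /cintegral !Rintegral_setU. Qed.

End ComplexIntegral.

Section CharacterIntegrals.
Variables (R : realType) (p : nat) (p_prime : prime p).
Local Notation K := (padic R p).
Local Notation nrm := (@padic_norm R p).
Local Notation P := (p%:R : R).
Local Notation ball := (@padic_ball R p).
Local Notation psi := (@padic_psi R p).
Variables (mu : {measure set K -> \bar R}) (mu_haar : normalized_haar mu).

(** The scale of local constancy depends only on x: the character is uniformly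
    locally constant. *)
Lemma padic_psi_mul_locconst (x y : K) : exists n : nat, forall z : K,
  nrm (z - y) <= P ^ (- n%:Z) -> psi (x * z) = psi (x * y).
Proof.
have [n xn] := padic_norm_leXn p_prime x.
exists n => z zy; apply: padic_psi_locconst => //.
rewrite -mulrBr padic_normM.
rewrite (le_trans (ler_pM (padic_norm_ge0 _) (padic_norm_ge0 _) xn zy))//.
by rewrite exprnP -expfzDr ?p_neq0// subrr.
Qed.

Lemma measurable_Re_psi (x : K) :
  measurable_fun setT (fun y : K => complex.Re (psi (x * y))).
Proof.
apply: measurable_locconst => // y; have [n Hn] := padic_psi_mul_locconst x y.
by exists n => z /Hn ->.
Qed.

Lemma measurable_Im_psi (x : K) :
  measurable_fun setT (fun y : K => complex.Im (psi (x * y))).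
Proof.
apply: measurable_locconst => // y; have [n Hn] := padic_psi_mul_locconst x y.
by exists n => z /Hn ->.
Qed.

Lemma bounded_integrable (D : set K) (f : K -> R) (M : R) : measurable D ->
  (mu D < +oo)%E -> measurable_fun setT f -> (forall y, D y -> `|f y| <= M) ->
  mu.-integrable D (EFin \o f).
Proof.
move=> mD Doo mf fM; apply: measurable_bounded_integrable => //.
  exact: measurable_funTS.
exists M; split; first exact: num_real.
by move=> N MN y Dy; exact: le_trans (fM _ Dy) (ltW MN).
Qed.

Lemma cintegrable_radial (D : set K) (x : K) (phi : R -> R) (M : R) :
  measurable D -> (mu D < +oo)%E -> (forall y, D y -> `|phi (nrm y)| <= M) ->
  cintegrable mu D (fun y => psi (x * y) * (phi (nrm y))%:C%C).
Proof.
move=> mD Doo phiM.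
have b (u : R) y : `|u| <= 1 -> D y -> `|u * phi (nrm y)| <= M.
  move=> u1 /phiM; apply: le_trans.
  by rewrite normrM -[leRHS]mul1r ler_wpM2r.
split.
- rewrite (_ : (fun y => _) = (fun y => complex.Re (psi (x * y)) * phi (nrm y))).
    apply: (@bounded_integrable _ _ M) => //.
      apply: measurable_funM; [exact: measurable_Re_psi|exact: measurable_radial].
    by move=> y; apply: b; exact: norm_Re_padic_psi.
  by apply/funext => y; rewrite /= mulr0 subr0.
- rewrite (_ : (fun y => _) = (fun y => complex.Im (psi (x * y)) * phi (nrm y))).
    apply: (@bounded_integrable _ _ M) => //.
      apply: measurable_funM; [exact: measurable_Im_psi|exact: measurable_radial].
    by move=> y; apply: b; exact: norm_Im_padic_psi.
  by apply/funext => y; rewrite /= mulr0 add0r.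
Qed.

Lemma cintegrable_psi (D : set K) (x : K) : measurable D -> (mu D < +oo)%E ->
  cintegrable mu D (fun y => psi (x * y)).
Proof.
move=> mD Doo; have := @cintegrable_radial D x (fun=> 1) 1 mD Doo.
rewrite (_ : (fun y => _) = (fun y => psi (x * y))).
  by apply=> y _; rewrite normr1.
by apply/funext => y; rewrite mulr1.
Qed.

Lemma haar_ball_lty a k : (mu (ball a k) < +oo)%E.
Proof. by rewrite haar_ball// ltry. Qed.

Lemma Rintegral_ball_translate (f : K -> R) (a : K) (k : int) (M : R) :
  nrm a <= P ^ k -> measurable_fun setT f -> (forall y, `|f y| <= M) ->
  \int[mu]_(y in ball 0 k) f (y + a) = \int[mu]_(y in ball 0 k) f y.
Proof.
move=> ak mf fM; have mt := measurable_translate p_prime a.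
have preB : (fun y => y + a) @^-1` ball 0 k = ball 0 k.
  apply/seteqP; split=> y; rewrite /padic_ball /= !subr0 => yk.
    by rewrite -[y](addrK a) padic_normB_le.
  exact: padic_norm_le.
rewrite /Rintegral; congr fine.
rewrite [RHS](eq_measure_integral (pushforward mu (fun y => y + a))); last first.
  by move=> A mA _; apply/esym; exact: (haar_translate mu_haar a mA).
have mB := measurable_padic_ball p_prime (0 : K) k.
have mEf : measurable_fun setT (EFin \o f) by exact/measurable_EFinP.
have fi : mu.-integrable ((fun y => y + a) @^-1` ball 0 k) (EFin \o f \o (fun y => y + a)).
  rewrite preB; change (mu.-integrable (ball 0 k) (EFin \o (fun y => f (y + a)))).
  apply: (bounded_integrable mB (haar_ball_lty _ _)).
    exact: (measurableT_comp mf mt).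
  by move=> y _; exact: (fM (y + a)).
have := integral_pushforward mt mEf fi mB; rewrite preB => e.
exact: (esym e).
Qed.

(** The integral of y |-> chi(x y) over the ball of radius p^k, see
    [cintegral_psi_ball]. *)
Definition ball_mass (x : K) (k : int) : R := if nrm x <= P ^ (- k) then P ^ k else 0.

(** If the character y |-> chi(x y) is trivial on the ball, the integral is the
    mass of the ball. Otherwise the ball, being a group, is invariant under
    translation by a point a with chi(x a) <> 1, and the integral I satisfies
    I = chi(x a) I. *)
Lemma cintegral_psi_ball (x : K) (k : int) :
  cintegral mu (ball 0 k) (fun y => psi (x * y)) = (ball_mass x k)%:C%C.
Proof.
have mB := measurable_padic_ball p_prime (0 : K) k.
have pP (j : int) : P ^ (- j) * P ^ j = 1 by rewrite -expfzDr ?p_neq0// addNr expr0z.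
rewrite /ball_mass; case: ifPn => xk.
  rewrite (@eq_cintegral _ _ _ _ _ (fun=> 1)) /cintegral; last first.
    move=> y; rewrite /padic_ball /= subr0 => yk; apply: padic_psi1 => //.
    rewrite padic_normM -(pP k).
    by apply: ler_pM => //; exact: padic_norm_ge0.
  by rewrite !Rintegral_cst// mul0r mul1r haar_ball.
have x0 : x != 0.
  by apply: contraNneq xk => ->; rewrite padic_norm0 ltW// pz_gt0.
(* the simplest point at which the character is not 1: x * a = 1 / p *)
pose a : K := (p%:R * x)^-1.
have ak : nrm a <= P ^ k.
  have [j xj] := padic_norm_pz x0.
  rewrite padic_normV padic_normM -[p%:R]expr1z padic_norm_pXz// xj.
  rewrite -expfzDr ?p_neq0// invr_expz pz_le//.
  by move: xk; rewrite xj pz_le//; lia.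
have xa : psi (x * a) <> 1.
  rewrite (_ : x * a = p%:R^-1); first exact: padic_psi_pV.
  by rewrite /a invfM mulrCA divff// mulr1.
set I := cintegral _ _ _.
have II : I = psi (x * a) * I.
  rewrite /I -cintegralZl//; last first.
    exact: cintegrable_psi (haar_ball_lty _ _).
  have ME y : psi (x * a) * psi (x * y) = psi (x * (y + a)).
    by rewrite [x * (y + a)]mulrDr (padic_psiD p_prime) [LHS]mulrC.
  rewrite (eq_cintegral mu (fun y _ => ME y)).
  have eR := Rintegral_ball_translate ak (measurable_Re_psi x)
    (fun y => norm_Re_padic_psi (x * y)).
  have eI := Rintegral_ball_translate ak (measurable_Im_psi x)
    (fun y => norm_Im_padic_psi (x * y)).
  exact: (congr2 (@Complex R) (esym eR) (esym eI)).
apply/eqP; have : (1 - psi (x * a)) * I = 0 by rewrite mulrBl mul1r -II subrr.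
move=> /eqP; rewrite mulf_eq0 subr_eq0 => /orP[/eqP h|//].
by case: xa; rewrite -h.
Qed.

Definition sphere (k : int) : set K := [set y | nrm y = P ^ k].

Lemma measurable_sphere k : measurable (sphere k).
Proof. exact: (measurable_padic_norm_preim p_prime [set P ^ k]). Qed.

Lemma sphere_lty k : (mu (sphere k) < +oo)%E.
Proof.
apply: le_lt_trans (haar_ball_lty 0 k); apply: le_measure; rewrite ?inE.
- exact: measurable_sphere.
- exact: measurable_padic_ball.
- by move=> y; rewrite /sphere /padic_ball /= subr0 => ->.
Qed.

Lemma padic_norm_lt_pz (y : K) (k : int) : (nrm y < P ^ k) = (nrm y <= P ^ (k - 1)).
Proof.
have [->|/padic_norm_pz[j ->]] := eqVneq y 0.
  by rewrite padic_norm0 pz_gt0// ltW// pz_gt0.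
by rewrite pz_lt// pz_le//; lia.
Qed.

(** The integral of y |-> chi(x y) over the sphere of radius p^k, see
    [cintegral_psi_sphere]. *)
Definition sphere_mass (x : K) (k : int) : R := ball_mass x k - ball_mass x (k - 1).

Lemma cintegral_psi_sphere (x : K) (k : int) :
  cintegral mu (sphere k) (fun y => psi (x * y)) = (sphere_mass x k)%:C%C.
Proof.
have E : ball 0 k = sphere k `|` ball 0 (k - 1).
  apply/seteqP; split=> y; rewrite /padic_ball /sphere /= !subr0.
    rewrite le_eqVlt padic_norm_lt_pz => /predU1P[|]; [by left|by right].
  by move=> [->//|yk]; rewrite (le_trans yk)// pz_le//; lia.
have := cintegral_psi_ball x k; rewrite E cintegral_setU.
- by rewrite cintegral_psi_ball /sphere_mass rmorphB /= => <-; rewrite addrK.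
- exact: measurable_sphere.
- exact: measurable_padic_ball.
- rewrite -E; apply: cintegrable_psi; [exact: measurable_padic_ball|].
  exact: haar_ball_lty.
- apply/disj_setPLR => y; rewrite /padic_ball /sphere /= subr0 => yk.
  by rewrite -padic_norm_lt_pz yk ltxx.
Qed.

(** The union of the n spheres of radii p^M, p^(M-1), ..., p^(M-n+1). Counting
    down from the outer radius makes the sums over shells partial sums of a series
    whose tail runs towards the origin. *)
Definition shell (M : int) (n : nat) : set K := [set y | P ^ (M - n%:Z) < nrm y <= P ^ M].

Lemma measurable_shell M n : measurable (shell M n).
Proof. exact: (measurable_padic_norm_preim p_prime [set r | P ^ (M - n%:Z) < r <= P ^ M]). Qed.

Lemma shell_lty M n : (mu (shell M n) < +oo)%E.
Proof.
apply: le_lt_trans (haar_ball_lty 0 M); apply: le_measure; rewrite ?inE.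
- exact: measurable_shell.
- exact: measurable_padic_ball.
- by move=> y; rewrite /padic_ball /= subr0 => /andP[].
Qed.

Lemma shellS M n : shell M n.+1 = shell M n `|` sphere (M - n%:Z).
Proof.
apply/seteqP; split=> y; rewrite /shell /sphere /=.
  move=> /andP[h ->]; rewrite andbT.
  have [|] := ltrP (P ^ (M - n%:Z)) (nrm y); [by left|right].
  apply/eqP; rewrite eq_le; apply/andP; split=> //.
  rewrite leNgt padic_norm_lt_pz -ltNge; apply: le_lt_trans h.
  by rewrite pz_le//; lia.
move=> [/andP[h ->]|->]; last by rewrite pz_lt// pz_le//; apply/andP; split; lia.
by rewrite andbT; apply: le_lt_trans h; rewrite pz_le//; lia.
Qed.

Lemma shell_radii M n y : shell M n y -> exists2 i : nat, (i < n)%N & nrm y = P ^ (M - i%:Z).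
Proof.
elim: n => [|n IH]; first by rewrite /shell /= subr0 => /andP[h /le_lt_trans/(_ h)]; rewrite ltxx.
rewrite shellS => -[/IH[i ilt ->]|->]; last by exists n.
by exists i => //; rewrite ltnS ltnW.
Qed.

Lemma cintegral_psi_shell (x : K) (phi : R -> R) (M : int) (n : nat) :
  cintegral mu (shell M n) (fun y => psi (x * y) * (phi (nrm y))%:C%C) =
  (\sum_(0 <= i < n) phi (P ^ (M - i%:Z)) * sphere_mass x (M - i%:Z))%:C%C.
Proof.
elim: n => [|n IH].
  rewrite big_geq// (_ : shell M 0 = set0) /cintegral ?Rintegral_set0//.
  by apply/seteqP; split=> // y /shell_radii[].
rewrite big_nat_recr//= rmorphD /= -IH shellS cintegral_setU.
- congr (_ + _); rewrite rmorphM /= -cintegral_psi_sphere -cintegralZl.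
  + by apply: eq_cintegral => y ->; rewrite mulrC.
  + exact: measurable_sphere.
  + apply: cintegrable_psi; [exact: measurable_sphere|exact: sphere_lty].
- exact: measurable_shell.
- exact: measurable_sphere.
- rewrite -shellS; apply: (@cintegrable_radial _ _ _
     (\sum_(i < n.+1) `|phi (P ^ (M - i%:Z))|)).
  + exact: measurable_shell.
  + exact: shell_lty.
  + move=> y /shell_radii[i ilt ->]; rewrite (bigD1 (Ordinal ilt))//= lerDl.
    by apply: sumr_ge0.
- apply/disj_setPLR => y /andP[h _] /=; rewrite /sphere /= => e.
  by move: h; rewrite e ltxx.
Qed.

End CharacterIntegrals.

(** * Term-by-term expansion of the exponential *)

Section ExponentialSums.
Variable R : realType.
Implicit Types u w : nat -> R.

Lemma expR_cvg (x : R) : series (exp_coeff x) @ \oo --> expR x.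
Proof. exact: is_cvg_series_exp_coeff. Qed.

Definition expR_tail (U : R) (n : nat) : R := expR U - series (exp_coeff U) n.

Lemma expR_tail_cvg0 (U : R) : expR_tail U n @[n --> \oo] --> 0.
Proof.
rewrite -[X in _ --> X](subrr (expR U)).
by apply: cvgB; [exact: cvg_cst|exact: expR_cvg].
Qed.

(** Term by term, the Taylor remainder at v is dominated by the one at U. *)
Lemma expR_taylor_bound (v U : R) (n : nat) : `|v| <= U ->
  `|expR v - series (exp_coeff v) n| <= expR_tail U n.
Proof.
move=> vU.
have c1 : `|series (exp_coeff v) N - series (exp_coeff v) n| @[N --> \oo] -->
    `|expR v - series (exp_coeff v) n|.
  by apply: cvg_norm; apply: cvgB; [exact: expR_cvg|exact: cvg_cst].
have c2 : series (exp_coeff U) N - series (exp_coeff U) n @[N --> \oo] -->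
    expR_tail U n.
  by apply: cvgB; [exact: expR_cvg|exact: cvg_cst].
apply: (ler_cvg_to c1 c2); exists n => // N /= nN.
rewrite !sub_series_geq//.
apply: le_trans (ler_norm_sum _ _ _) _; apply: ler_sum => i _.
rewrite /exp_coeff /= normrM normrX [`|_^-1|]ger0_norm ?invr_ge0//.
by rewrite ler_wpM2r ?invr_ge0// lerXn2r// ?nnegrE// (le_trans _ vU).
Qed.

Lemma series_lincomb (n : nat) (a : nat -> R) (f : nat -> nat -> R) (L : nat -> R) :
  (forall k, series (f k) @ \oo --> L k) ->
  series (fun i => \sum_(0 <= k < n) a k * f k i) @ \oo -->
    \sum_(0 <= k < n) a k * L k.
Proof.
move=> fL; rewrite (_ : series _ = fun N => \sum_(0 <= k < n) a k * series (f k) N).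
  elim: n => [|n IH].
    rewrite big_geq// (_ : (fun N => _) = fun=> 0); first exact: cvg_cst.
    by apply/funext => N; rewrite big_geq.
  rewrite big_nat_recr//= (_ : (fun N => _) = (fun N =>
      \sum_(0 <= k < n) a k * series (f k) N + a n * series (f n) N)).
    by apply: cvgD => //; exact: cvgMr.
  by apply/funext => N; rewrite big_nat_recr.
apply/funext => N; rewrite /series /= exchange_big /=.
by apply: eq_bigr => k _; rewrite mulr_sumr.
Qed.

(** The Taylor remainder of the exponential is uniformly small on bounded sets, so
    under a series with bounded exponents u_i and summable weights w_i the error of
    the n-th Taylor polynomial is at most the remainder at U times the sum of the
    weights. *)
Lemma series_expR_expand u w (U : R) (L : nat -> R) :
  (forall i, 0 <= u i <= U) -> (forall i, 0 <= w i) ->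
  (forall k, series (fun i => u i ^+ k * w i) @ \oo --> L k) ->
  exists E : R, series (fun i => expR (- u i) * w i) @ \oo --> E /\
    series (fun k => (-1) ^+ k / k`!%:R * L k) @ \oo --> E.
Proof.
move=> uU w0 uL.
have wL : series w @ \oo --> L 0%N.
  by rewrite (_ : w = fun i => u i ^+ 0 * w i)//; apply/funext => i; rewrite mul1r.
have /cvg_ex[E EP] : cvgn (series (fun i => expR (- u i) * w i)).
  apply: series_le_cvg (cvgP _ wL) => // i.
    by rewrite mulr_ge0// expR_ge0.
  by rewrite -[leRHS]mul1r ler_wpM2r// -expR0 ler_expR oppr_le0; case/andP: (uU i).
exists E; split=> //.
apply/subr_cvg0/norm_cvg0P; apply: (@squeeze_cvgr _ _ _ _ (fun=> 0) (fun n => expR_tail U n * L 0%N)).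
- apply: nearW => n; rewrite normr_ge0 /=.
  have c := @series_lincomb n (fun k => (-1) ^+ k / k`!%:R) _ _ uL.
  have {}c : `|series (fun i => \sum_(0 <= k < n) (-1) ^+ k / k`!%:R * (u i ^+ k * w i)) N
      - series (fun i => expR (- u i) * w i) N| @[N --> \oo] -->
      `|series (fun k => (-1) ^+ k / k`!%:R * L k) n - E|.
    exact: cvg_norm (cvgB c EP).
  have d : expR_tail U n * series w N @[N --> \oo] --> expR_tail U n * L 0%N.
    exact: cvgMr.
  apply: (ler_cvg_to c d); apply: nearW => N /=.
  rewrite /series /= -sumrB mulr_sumr.
  apply: le_trans (ler_norm_sum _ _ _) _; apply: ler_sum => i _.
  have -> : \sum_(0 <= k < n) (-1) ^+ k / k`!%:R * (u i ^+ k * w i) =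
      series (exp_coeff (- u i)) n * w i.
    rewrite /series /= mulr_suml; apply: eq_bigr => k _.
    by rewrite /exp_coeff /= [(- u i) ^+ k]exprNn; ring.
  rewrite -mulrBl normrM [`|w i|]ger0_norm// ler_wpM2r// distrC.
  by apply: expR_taylor_bound; rewrite normrN ger0_norm; case/andP: (uU i).
- exact: cvg_cst.
- by rewrite -[X in _ --> X](mul0r (L 0%N)); apply: cvgMl; exact: expR_tail_cvg0.
Qed.

Lemma cvg_real_complex (u : nat -> R) (l : R) : u @ \oo --> l ->
  ((u n)%:C%C : R[i]^o) @[n --> \oo] --> (l%:C%C : R[i]^o).
Proof.
move=> ul; apply/cvgrPdist_lt => e e0.
have [eR e00] : e = (complex.Re e)%:C%C /\ 0 < complex.Re e.
  by move: e0; rewrite ltcE /= => /andP[/eqP h1 h2]; split=> //; case: (e) h1 => a b /= ->.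
move/cvgrPdist_lt : ul => /(_ _ e00)[N _ HN]; exists N => // n Nn.
by rewrite -rmorphB /= normc_def /= expr0n addr0 sqrtr_sqr eR ltcR; exact: HN.
Qed.

End ExponentialSums.

(** * Radial Fourier integrals and the gamma function *)

Section RadialFourier.
Variables (R : realType) (p : nat) (p_prime : prime p).
Local Notation K := (padic R p).
Local Notation nrm := (@padic_norm R p).
Local Notation P := (p%:R : R).
Local Notation ball := (@padic_ball R p).
Local Notation psi := (@padic_psi R p).
Variables (mu : {measure set K -> \bar R}) (mu_haar : normalized_haar mu).

Definition annulus (N : nat) : set K := [set x | P ^- N <= nrm x <= P ^+ N].

Lemma annulusE (N : nat) : annulus N = shell N N.*2.+1.
Proof.
apply/seteqP; split=> y; rewrite /annulus /shell /= exprnN => /andP[h1 h2].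
- apply/andP; split=> //; apply: lt_le_trans h1; rewrite pz_lt//; lia.
- apply/andP; split=> //; rewrite leNgt padic_norm_lt_pz// -ltNge.
  by apply: le_lt_trans h1; rewrite pz_le//; lia.
Qed.

Section Fixed.
Variables (x : K) (m : int) (xm : nrm x = P ^ (- m)).

Lemma sphere_mass_le k : k <= m -> sphere_mass x k = P ^ k * (1 - P^-1).
Proof.
move=> km; rewrite /sphere_mass /ball_mass xm !pz_le// !lerN2 km.
rewrite ifT; last by lia.
by rewrite expfzDr ?p_neq0// mulrBr mulr1.
Qed.

Lemma sphere_mass_succ : sphere_mass x (m + 1) = - P ^ m.
Proof.
rewrite /sphere_mass /ball_mass xm !pz_le// !lerN2 addrK lexx ifF ?sub0r//.
by apply/negbTE; lia.
Qed.

Lemma sphere_mass_gt k : m + 1 < k -> sphere_mass x k = 0.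
Proof.
by move=> mk; rewrite /sphere_mass /ball_mass xm !pz_le// !lerN2 !ifF ?subrr//;
  apply/negbTE; lia.
Qed.

(** The contributions of the spheres of radius at most p^m = 1 / |x|, on which the
    character y |-> chi(x y) is trivial. *)
Definition radial_series (phi : R -> R) : nat -> R :=
  series (fun i => phi (P ^ (m - i%:Z)) * (P ^ (m - i%:Z) * (1 - P^-1))).

Lemma cintegral_psi_annulus (phi : R -> R) (N : nat) : (`|m| < N)%N ->
  cintegral mu (annulus N) (fun y => psi (x * y) * (phi (nrm y))%:C%C) =
  (radial_series phi `|N%:Z + m + 1| - phi (P ^ (m + 1)) * P ^ m)%:C%C.
Proof.
move=> mN; rewrite annulusE cintegral_psi_shell//; congr (_%:C)%C.
(* the d outermost spheres contribute nothing *)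
pose d := `|(N%:Z - m - 1)%R|%N.
have dE : (N%:Z = m + 1 + d%:Z)%R by rewrite /d; lia.
have -> : N.*2.+1 = (d + (`|(N%:Z + m + 1)%R|).+1)%N by rewrite /d; lia.
rewrite (@big_cat_nat _ _ _ d)//= ?leq_addr//.
rewrite big_nat_cond big1 ?add0r; last first.
  by move=> i /andP[/andP[_ id] _]; rewrite sphere_mass_gt ?mulr0//; lia.
rewrite -{1}[d]add0n big_addn addKn big_nat_recl//= add0n.
have -> : N%:Z - d%:Z = m + 1 by lia.
rewrite sphere_mass_succ mulrN addrC; congr (_ - _).
apply: eq_big_nat => i _.
have -> : N%:Z - (i.+1 + d)%N%:Z = m - i%:Z by lia.
by rewrite sphere_mass_le//; lia.
Qed.

Lemma cvg_radial_series_shift (phi : R -> R) (l b : R) :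
  radial_series phi @ \oo --> l ->
  radial_series phi `|(N%:Z + m + 1)%R|%N - b @[N --> \oo] --> l - b.
Proof.
move=> cl; apply: cvgB; last exact: cvg_cst.
apply: (@cvg_comp _ _ _ (fun N : nat => `|(N%:Z + m + 1)%R|%N) _ _ \oo _ _ cl) => A [k _ kA].
by exists (k + `|m|)%N => // N /= kN; apply: kA => /=; lia.
Qed.

Lemma cvg_cintegral_psi_annulus (phi : R -> R) (l : R) :
  radial_series phi @ \oo --> l ->
  (cintegral mu (annulus N) (fun y => psi (x * y) * (phi (nrm y))%:C%C) : R[i]^o)
    @[N --> \oo] --> ((l - phi (P ^ (m + 1)) * P ^ m)%:C%C : R[i]^o).
Proof.
move=> /(@cvg_radial_series_shift _ _ (phi (P ^ (m + 1)) * P ^ m)) c.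
apply: cvg_trans (cvg_real_complex c); apply: near_eq_cvg.
by exists `|m|.+1 => // N /= mN; rewrite cintegral_psi_annulus.
Qed.

End Fixed.

Lemma powRz_sub (m : int) (i : nat) (a : R) :
  (P ^ (m - i%:Z)) `^ a = (P ^ m) `^ a * (P `^ (- a)) ^+ i.
Proof.
have P0 := ltW (p_gt0 R p_prime).
rewrite expfzDr ?p_neq0// powRM ?(ltW (pz_gt0 _ _ _))//; congr (_ * _).
rewrite -powR_intmul// -powRrM mulrC mulrNz mulrN -mulNr powRrM.
by rewrite -pmulrn powR_mulrn// powR_ge0.
Qed.

Definition gelfand_graev (s : R) : R := (1 - P `^ (s - 1)) / (1 - P `^ (- s)).

Lemma powRN_lt1 (s : R) : 0 < s -> P `^ (- s) < 1.
Proof.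
move=> s0; rewrite powRN invf_lt1 ?powR_gt0 ?p_gt0//.
have := @gt0_ltr_powR R s s0 1 P; rewrite powR1; apply; last exact: p_gt1.
  exact: ler01.
exact: (ltW (p_gt0 R p_prime)).
Qed.

Lemma radial_series_powR (m : int) (s : R) : 0 < s ->
  radial_series m (fun r => r `^ (s - 1)) @ \oo -->
  (P ^ m) `^ s * (1 - P^-1) / (1 - P `^ (- s)).
Proof.
move=> s0; have P0 := p_gt0 R p_prime.
have E : (fun i : nat => (P ^ (m - i%:Z)) `^ (s - 1) * (P ^ (m - i%:Z) * (1 - P^-1))) =
    geometric ((P ^ m) `^ s * (1 - P^-1)) (P `^ (- s)).
  apply/funext => i /=; rewrite mulrA.
  have -> : (P ^ (m - i%:Z)) `^ (s - 1) * P ^ (m - i%:Z) = (P ^ (m - i%:Z)) `^ s.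
    rewrite -{2}[P ^ (m - i%:Z)]powRr1 ?(ltW (pz_gt0 _ _ _))// -powRD ?subrK//.
    by apply/implyP => _; rewrite gt_eqF// pz_gt0.
  by rewrite powRz_sub mulrAC.
rewrite /radial_series E; apply: cvg_geometric_series.
by rewrite ger0_norm ?powR_ge0 ?powRN_lt1.
Qed.

(** For phi(r) = r^(s-1) the two parts of the radial formula combine into the
    Gel'fand--Graev value times p^(m s) = |x|^-s. *)
Lemma radial_limit_powR (m : int) (s : R) : 0 < s ->
  (P ^ m) `^ s * (1 - P^-1) / (1 - P `^ (- s)) - (P ^ (m + 1)) `^ (s - 1) * P ^ m =
  (P ^ m) `^ s * gelfand_graev s.
Proof.
move=> s0; have P0 := p_gt0 R p_prime.
have nz : 1 - P `^ (- s) != 0 by rewrite subr_eq0 gt_eqF// powRN_lt1.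
have pm : (P ^ m) != 0 by rewrite gt_eqF// pz_gt0.
have e1 : (P ^ (m + 1)) `^ (s - 1) * P ^ m = (P ^ m) `^ s * P `^ (s - 1).
  rewrite expfzDr ?p_neq0// expr1z powRM ?(ltW P0)// ?(ltW (pz_gt0 _ _ _))//.
  rewrite mulrAC; congr (_ * _).
  rewrite -{2}[P ^ m]powRr1 ?(ltW (pz_gt0 _ _ _))// -powRD ?subrK//.
  by apply/implyP.
have e2 : P `^ (s - 1) * P `^ (- s) = P^-1.
  rewrite -powRD; last by apply/implyP => _; rewrite gt_eqF.
  by rewrite addrAC subrr add0r powR_inv1// ltW.
rewrite e1 /gelfand_graev -mulrA -mulrBr; congr (_ * _).
apply: (mulIf nz); rewrite mulrBl !divfK// mulrBr mulr1 e2; ring.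
Qed.

Lemma padic_GammaE (s : R) : 0 < s -> padic_Gamma mu s = (gelfand_graev s)%:C%C.
Proof.
move=> s0; rewrite /padic_Gamma.
apply: (@cvg_lim (R[i]^o)); first exact: norm_hausdorff.
have n1 : nrm 1 = P ^ (- 0) by rewrite oppr0 expr0z padic_norm1.
have := cvg_cintegral_psi_annulus n1 (@radial_series_powR 0 s s0).
rewrite (radial_limit_powR 0 s0).
have -> : (P ^ (0 : int)) `^ s * gelfand_graev s = gelfand_graev s.
  by rewrite expr0z powR1 mul1r.
apply: cvg_trans; apply: near_eq_cvg; apply: nearW => N.
by apply: eq_cintegral => y _; rewrite padic_charE mulr1 mul1r.
Qed.

End RadialFourier.

(** * The series for the density *)

Section StableDensity.
Variables (R : realType) (p : nat) (p_prime : prime p).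
Local Notation K := (padic R p).
Local Notation nrm := (@padic_norm R p).
Local Notation P := (p%:R : R).
Local Notation ball := (@padic_ball R p).
Local Notation psi := (@padic_psi R p).
Variables (mu : {measure set K -> \bar R}) (mu_haar : normalized_haar mu).

(** The function is dominated by a constant multiple of \sum_k p^(-2k) 1_(B_k),
    with B_k the ball of radius p^k, whose integral is a geometric series. *)
Lemma integrable_radial_decay (phi : R -> R) (C : R) :
  (forall r, 0 <= r <= 1 -> `|phi r| <= C) ->
  (forall r, 1 <= r -> `|phi r| <= C * r ^- 2) ->
  mu.-integrable setT (EFin \o (fun y : K => phi (nrm y))).
Proof.
move=> phi0 phi1.
have C0 : 0 <= C by apply: le_trans (phi0 0 _); rewrite ?lexx ?ler01.
have P0 := p_gt0 R p_prime.
pose g (k : nat) (y : K) : \bar R := ((C * P^-1 ^+ (2 * k))%:E * (\1_(ball 0 k) y)%:E)%E.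
have gc0 k : 0 <= C * P^-1 ^+ (2 * k) by rewrite mulr_ge0// exprn_ge0// invr_ge0 ltW.
have g0 k y : (0 <= g k y)%E by rewrite /g -EFinM lee_fin mulr_ge0// indicE.
have mphi : measurable_fun setT (fun y : K => phi (nrm y)) by exact: measurable_radial.
have mB k : measurable (ball 0 k) := measurable_padic_ball p_prime (0 : K) k.
have mg k : measurable_fun setT (g k).
  by apply: measurable_funeM; apply/measurable_EFinP; exact: measurable_indic.
apply/integrableP; split; first exact/measurable_EFinP.
have le_g y : (`|(phi (nrm y))%:E| <= \sum_(k <oo) g k y)%E.
  suff [k hk] : exists k, (`|(phi (nrm y))%:E| <= g k y)%E.
    apply: (le_trans hk); apply: le_trans (@nneseries_lim_ge _ _ xpredT 0 k.+1 _) => //.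
    by rewrite big_nat_recr//= leeDr// sume_ge0.
  have [y1|y1] := leP (nrm y) 1.
    exists 0%N; rewrite /g muln0 expr0 mulr1 indicE mem_set.
      by rewrite mule1 lee_fin phi0// y1 padic_norm_ge0.
    by rewrite /padic_ball /= subr0 expr0z.
  have y0 : y != 0 by apply: contraTneq y1 => ->; rewrite padic_norm0 -leNgt.
  have [j yj] := padic_norm_pz y0.
  have j0 : 0 < j by move: y1; rewrite yj -[X in X < _](expr0z P) pz_lt.
  exists `|j|%N; rewrite /g indicE mem_set ?mule1.
    rewrite lee_fin; apply: le_trans (phi1 _ (ltW y1)) _.
    by rewrite yj mulnC exprM exprVn -[X in X ^ j]/P -[j in X in X <= _]gez0_abs ?(ltW j0)// exprVn exprnP.
  by rewrite /padic_ball /= subr0 yj pz_le//; lia.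
apply: (@le_lt_trans _ _ (\int[mu]_(y in setT) \sum_(k <oo) g k y)%E).
  apply: ge0_le_integral => //=.
  - exact: (measurable_radial p_prime (fun r => `|phi r|%:E)).
  - have := @ge0_emeasurable_sum _ _ _ setT g xpredT (fun k y _ _ => g0 k y)
      (fun k _ => mg k).
    by apply: eq_measurable_fun.
  - by move=> y _; exact: le_g.
rewrite integral_nneseries//.
rewrite (@eq_eseriesr _ _ (fun k => (geometric C P^-1 k)%:E)); last first.
  move=> k _; rewrite ge0_integralZl_EFin//.
  - rewrite integral_indic// setIT haar_ball// -EFinM /geometric /=; congr _%:E.
    rewrite mul2n -addnn exprD -!mulrA -exprnP -exprMn mulVf ?gt_eqF//.
    by rewrite expr1n mulr1.
  - by apply/measurable_EFinP; exact: measurable_indic.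
have Pi : `|P^-1| < 1 by rewrite ger0_norm ?invr_ge0 ?ltW// invf_lt1 ?p_gt1.
have -> : (fun n => \sum_(0 <= k < n) (geometric C P^-1 k)%:E)%E =
    EFin \o series (geometric C P^-1).
  by apply/funext => n; rewrite /= sumEFin.
by rewrite EFin_lim ?ltry//; exact: is_cvg_geometric_series.
Qed.

(** The origin may be left out of the exhausting sets because points are null for
    Haar measure; this covers the annuli as well as the balls. *)
Lemma cvg_Rintegral_exhaustion (f : K -> R) (F : nat -> set K) :
  mu.-integrable setT (EFin \o f) -> (forall n, measurable (F n)) ->
  (forall y, y != 0 -> exists N, forall n, (N <= n)%N -> F n y) ->
  \int[mu]_(y in F n) f y @[n --> \oo] --> \int[mu]_y f y.
Proof.
move=> fi mF Fe.
have mf : measurable_fun setT (EFin \o f) := measurable_int mu fi.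
have [] := @dominated_convergence _ _ _ mu setT measurableT
  (fun n => (EFin \o f) \_ (F n)) (EFin \o f) (abse \o (EFin \o f)).
- by move=> n; apply: (measurable_restrictT _ (mF n)).1; exact: measurable_funTS.
- exact: mf.
- exists [set 0]; split.
  + exact: measurable_padic_set1.
  + exact: haar_set1.
  + move=> y /= h; apply: contrapT => /eqP y0; apply: h => _.
    have [N HN] := Fe y y0; apply: cvg_near_cst; exists N => // n /= Nn.
    by rewrite patchE mem_set//; exact: HN.
- exact: integrable_abse.
- apply: aeW => y n _; rewrite patchE; case: ifP => // _.
  by rewrite abse0 abse_ge0.
move=> _ _; have -> : (\int[mu]_y (EFin \o f) y = (\int[mu]_y f y)%:E)%E.
  by rewrite /Rintegral fineK//; exact: integrable_fin_num.
move=> /fine_cvg; apply: cvg_trans; apply: near_eq_cvg; apply: nearW => n /=.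
by rewrite /Rintegral [in RHS]integral_mkcond.
Qed.

Variables (c gamma t : R) (c_gt0 : 0 < c) (gamma_gt0 : 0 < gamma) (t_gt0 : 0 < t).

Definition stable_profile (r : R) : R := expR (- (c * t * r `^ gamma)).

Lemma integrable_stable_cf : mu.-integrable setT (EFin \o @stable_cf R p c gamma t).
Proof.
have ct0 : 0 < c * t by rewrite mulr_gt0.
(* n + 1 is an exponent large enough for r^(gamma (n + 1)) to dominate r^2 *)
pose n := Num.truncn (2 / gamma).
have nP : 2 <= gamma * n.+1%:R.
  by rewrite mulrC -ler_pdivrMr// ltW// truncnS_gt.
pose C := Num.max 1 (n.+1`!%:R / (c * t) ^+ n.+1).
apply: (@integrable_radial_decay stable_profile C) => r.
  move=> /andP[r0 r1]; rewrite ger0_norm ?expR_ge0// le_max; apply/orP; left.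
  by rewrite -expR0 ler_expR oppr_le0 mulr_ge0 ?powR_ge0// ltW.
move=> r1; have r0 : 0 < r by exact: lt_le_trans r1.
rewrite ger0_norm ?expR_ge0// /stable_profile expRN.
apply: (@le_trans _ _ (n.+1`!%:R / (c * t) ^+ n.+1 * r ^- 2)); last first.
  by rewrite ler_wpM2r ?invr_ge0 ?exprn_ge0 ?(ltW r0)// le_max lexx orbT.
have -> : n.+1`!%:R / (c * t) ^+ n.+1 * r ^- 2 = ((c * t) ^+ n.+1 / n.+1`!%:R * r ^+ 2)^-1.
  by rewrite !invfM invrK [X in _ = X * _]mulrC.
rewrite lef_pV2 ?posrE ?expR_gt0//; last first.
  by rewrite mulr_gt0 ?divr_gt0 ?exprn_gt0// ltr0n fact_gt0.
have u0 : 0 <= c * t * r `^ gamma by rewrite mulr_ge0 ?powR_ge0// ltW.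
apply: le_trans (expR_ge1Dxn n u0).
rewrite ler_wpDl// [X in _ <= X / _](exprMn _ (c * t)) mulrAC ler_wpM2r ?invr_ge0//.
rewrite ler_wpM2l//; first by rewrite exprn_ge0// ltW.
rewrite -(powR_mulrn 2 (ltW r0)) -(powR_mulrn n.+1 (powR_ge0 r gamma)) -powRrM.
by rewrite ler_powR.
Qed.

End StableDensity.

Section StableSeries.
Variables (R : realType) (p : nat) (p_prime : prime p).
Local Notation K := (padic R p).
Local Notation nrm := (@padic_norm R p).
Local Notation P := (p%:R : R).
Local Notation ball := (@padic_ball R p).
Local Notation psi := (@padic_psi R p).
Variables (mu : {measure set K -> \bar R}) (mu_haar : normalized_haar mu).
Variables (c gamma t : R) (c_gt0 : 0 < c) (gamma_gt0 : 0 < gamma) (t_gt0 : 0 < t).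
Local Notation phi := (stable_profile c gamma t).

Lemma cintegrable_stable (x : K) :
  cintegrable mu setT (fun y => padic_char y x * (stable_cf c gamma t y)%:C%C).
Proof.
have ig := integrable_stable_cf p_prime mu_haar c_gt0 gamma_gt0 t_gt0.
have mphi : measurable_fun setT (fun y : K => phi (nrm y)).
  exact: (measurable_radial p_prime phi).
have b (u : R) y : `|u| <= 1 -> `|u * phi (nrm y)| <= `|phi (nrm y)|.
  by move=> u1; rewrite normrM -[leRHS]mul1r ler_wpM2r.
split.
- apply: (@le_integrable _ _ _ mu setT measurableT _ (EFin \o @stable_cf R p c gamma t)) => //.
    apply/measurable_EFinP.
    rewrite (_ : (fun y => _) = (fun y => complex.Re (psi (x * y)) * phi (nrm y))).
      by apply: measurable_funM => //; exact: measurable_Re_psi.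
    by apply/funext => y; rewrite /= mulr0 subr0.
  move=> y _; rewrite /= mulr0 subr0 lee_fin.
  by apply: (b (complex.Re (psi (x * y)))); exact: norm_Re_padic_psi.
- apply: (@le_integrable _ _ _ mu setT measurableT _ (EFin \o @stable_cf R p c gamma t)) => //.
    apply/measurable_EFinP.
    rewrite (_ : (fun y => _) = (fun y => complex.Im (psi (x * y)) * phi (nrm y))).
      by apply: measurable_funM => //; exact: measurable_Im_psi.
    by apply/funext => y; rewrite /= mulr0 add0r.
  move=> y _; rewrite /= mulr0 add0r lee_fin.
  by apply: (b (complex.Im (psi (x * y)))); exact: norm_Im_padic_psi.
Qed.

Lemma cvg_near_unique (a b : nat -> R) (la lb : R) (N : nat) :
  (forall n, (N < n)%N -> a n = b n) -> a @ \oo --> la -> b @ \oo --> lb -> la = lb.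
Proof.
move=> ab ca cb; apply: (@cvg_unique _ (@Rhausdorff R) (b @ \oo)) => //.
by apply: cvg_trans ca; apply: near_eq_cvg; exists N.+1 => // n /= /ab ->.
Qed.

Lemma measurable_annulus N : measurable (@annulus R p N).
Proof. by rewrite annulusE//; exact: measurable_shell. Qed.

Lemma annulus_exhaust (y : K) : y != 0 ->
  exists N, forall n, (N <= n)%N -> @annulus R p n y.
Proof.
move=> /padic_norm_pz[k yk]; exists `|k|%N => n kn.
by rewrite /annulus /= yk exprnN exprnP !pz_le//; lia.
Qed.

Lemma stable_density_radial (x : K) (m : int) (l : R) : nrm x = P ^ (- m) ->
  radial_series p m phi @ \oo --> l ->
  stable_density mu c gamma t x = (l - phi (P ^ (m + 1)) * P ^ m)%:C%C.
Proof.
move=> xm cl; have [fr fi] := cintegrable_stable x.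
have cR := cvg_Rintegral_exhaustion p_prime mu_haar fr measurable_annulus annulus_exhaust.
have cI := cvg_Rintegral_exhaustion p_prime mu_haar fi measurable_annulus annulus_exhaust.
have e N : (`|m| < N)%N -> cintegral mu (@annulus R p N)
    (fun y => padic_char y x * (stable_cf c gamma t y)%:C%C) =
    (radial_series p m phi `|(N%:Z + m + 1)%R|%N - phi (P ^ (m + 1)) * P ^ m)%:C%C.
  exact: (cintegral_psi_annulus p_prime mu_haar xm phi).
have c0 : radial_series p m phi `|(N%:Z + m + 1)%R|%N - phi (P ^ (m + 1)) * P ^ m @[N --> \oo] -->
    l - phi (P ^ (m + 1)) * P ^ m.
  exact: cvg_radial_series_shift.
congr (_ +i* _)%C.
- by apply: cvg_near_unique cR c0 => N /e [-> _].
- by apply: cvg_near_unique cI (cvg_cst 0) => N /e [_ ->].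
Qed.

(** The annulus formula at exp(- c t r^gamma) splits into the series over the inner
    spheres, expanded by [series_expR_expand], and the single sphere of radius
    p^(m+1), expanded by the exponential series; the two n-th terms add up to
    |x|^-(n gamma + 1) Gamma_p(n gamma + 1) by [radial_limit_powR]. *)
Lemma stable_density_series (x : K) : x != 0 ->
  series (fun n : nat => (-1) ^+ n / n`!%:R *
      ((c * t) ^+ n / nrm x `^ (n%:R * gamma + 1))%:C%C *
      padic_Gamma mu (n%:R * gamma + 1) : R[i]^o)
    @ \oo --> (stable_density mu c gamma t x : R[i]^o).
Proof.
move=> x0; have [m xm] : exists m : int, nrm x = P ^ (- m).
  by have [k xk] := padic_norm_pz x0; exists (- k); rewrite opprK.
have ct0 : 0 < c * t by rewrite mulr_gt0.
have s0 (n : nat) : 0 < n%:R * gamma + 1 by rewrite ltr_wpDl// mulr_ge0// ltW.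
have Pm0 (k : int) : 0 <= P ^ k := ltW (pz_gt0 R p_prime k).
pose u (i : nat) := c * t * (P ^ (m - i%:Z)) `^ gamma.
pose w (i : nat) := P ^ (m - i%:Z) * (1 - P^-1).
pose W (n : nat) := (P ^ m) `^ (n%:R * gamma + 1) * (1 - P^-1) /
  (1 - P `^ (- (n%:R * gamma + 1))).
have powE (r : R) (n : nat) : 0 <= r ->
    r `^ (n%:R * gamma + 1 - 1) = (r `^ gamma) ^+ n.
  by move=> r0; rewrite addrK mulrC powRrM powR_mulrn// powR_ge0.
have uwW n : series (fun i => u i ^+ n * w i) @ \oo --> (c * t) ^+ n * W n.
  have := @radial_series_powR R p p_prime m _ (s0 n).
  move=> /(@cvgMr _ _ _ _ _ ((c * t) ^+ n)).
  apply: cvg_trans; apply: near_eq_cvg; apply: nearW => N.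
  rewrite /radial_series /series /= mulr_sumr; apply: eq_bigr => i _.
  by rewrite /u /w powE// (exprMn n (c * t)) mulrA.
have w0 i : 0 <= w i.
  by rewrite mulr_ge0// subr_ge0 invf_le1 ?p_gt0// ltW// p_gt1.
have uU i : 0 <= u i <= c * t * (P ^ m) `^ gamma.
  rewrite mulr_ge0 ?powR_ge0 ?(ltW ct0)//= ler_wpM2l ?(ltW ct0)//.
  apply: ge0_ler_powR; rewrite ?nnegrE ?(ltW gamma_gt0)// pz_le//; lia.
have [E [cE cS]] := series_expR_expand uU w0 uwW.
rewrite (stable_density_radial xm cE).
pose v := c * t * (P ^ (m + 1)) `^ gamma.
have cV : series (exp_coeff (- v)) n * P ^ m @[n --> \oo] --> phi (P ^ (m + 1)) * P ^ m.
  by apply: cvgMl; exact: expR_cvg.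
apply: cvg_trans (cvg_real_complex (cvgB cS cV)).
apply: near_eq_cvg; apply: nearW => N.
rewrite /series /= !fctE mulr_suml -sumrB rmorph_sum; apply: eq_bigr => n _.
rewrite padic_GammaE//.
have -> : (-1) ^+ n / n`!%:R = ((-1) ^+ n / n`!%:R)%:C%C :> R[i].
  by rewrite rmorphM /= rmorphXn rmorphN rmorph1 fmorphV rmorph_nat.
rewrite -!rmorphM /=; congr (_%:C)%C.
have -> : nrm x `^ (n%:R * gamma + 1) = ((P ^ m) `^ (n%:R * gamma + 1))^-1.
  rewrite xm -invr_expz; apply: (mulIf (x := (P ^ m) `^ (n%:R * gamma + 1))).
    by rewrite gt_eqF// powR_gt0// pz_gt0.
  rewrite -powRM ?invr_ge0// !mulVf ?powR1// gt_eqF// ?powR_gt0// pz_gt0//.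
rewrite invrK -!mulrA -(radial_limit_powR p_prime m (s0 n)) powE// /exp_coeff /=.
rewrite [(- v) ^+ n]exprNn /v (exprMn n (c * t)) /W; ring.
Qed.

End StableSeries.

(** * Fourier inversion *)

Section FourierInversion.
Variables (R : realType) (p : nat) (p_prime : prime p).
Local Notation K := (padic R p).
Local Notation nrm := (@padic_norm R p).
Local Notation P := (p%:R : R).
Local Notation ball := (@padic_ball R p).
Local Notation psi := (@padic_psi R p).
Variables (mu : {measure set K -> \bar R}) (mu_haar : normalized_haar mu).

Lemma padic_ball_exhaust (y : K) : exists N, forall n : nat, (N <= n)%N -> ball 0 n%:Z y.
Proof.
have [N yN] := padic_norm_leXn p_prime y; exists N => n Nn.
by rewrite /padic_ball /= subr0 (le_trans yN)// exprnP pz_le.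
Qed.

(** The integral over the ball is one with respect to the restricted measure, which is
    finite, so bounded functions are integrable on the product. *)
Lemma Fubini_locconst (rho : probability K R) (k : K * K -> R) (n : int) :
  (forall u, exists N : nat, forall v, nrm (v.1 - u.1) <= P ^ (- N%:Z) ->
     nrm (v.2 - u.2) <= P ^ (- N%:Z) -> k v = k u) ->
  (forall u, `|k u| <= 1) ->
  \int[mu]_(y in ball 0 n) \int[rho]_z k (y, z) =
  \int[rho]_z \int[mu]_(y in ball 0 n) k (y, z).
Proof.
move=> kloc k1.
have mB : measurable (ball 0 n) := measurable_padic_ball p_prime (0 : K) n.
have mk : measurable_fun setT k := measurable_locconst2 p_prime kloc.
have kz y : rho.-integrable setT (EFin \o (fun z => k (y, z))).
  apply: (@bounded_integrable _ _ rho setT (fun z => k (y, z)) 1) => //.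
  - by rewrite [X in (X < _)%E]probability_setT ltry.
  - exact: (measurable_fun_pair2 y mk).
have ky z : mu.-integrable (ball 0 n) (EFin \o (fun y => k (y, z))).
  apply: (@bounded_integrable _ _ mu (ball 0 n) (fun y => k (y, z)) 1) => //.
  - exact: haar_ball_lty.
  - exact: (measurable_fun_pair1 z mk).
pose m : {finite_measure set K -> \bar R} :=
  mfrestr mB (haar_ball_lty p_prime mu_haar (0 : K) n).
have mE A : measurable A -> A `<=` ball 0 n -> mu A = m A.
  by move=> _ AB; rewrite /m /= /mfrestr /mrestr setIidl.
have mlt : (m (ball 0%R n) < +oo)%E by rewrite -mE//; exact: haar_ball_lty.
pose b (u : K * K) : \bar R := (\1_(ball 0 n) u.1)%:E.
pose f (u : K * K) : \bar R := (k u * \1_(ball 0 n) u.1)%:E.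
have m1 : measurable_fun setT (fun u : K * K => \1_(ball 0 n) u.1 : R).
  exact: (measurableT_comp (measurable_indic mB) measurable_fst).
have bi : (m \x rho)%E.-integrable setT b.
  apply/integrable12ltyP; first exact/measurable_EFinP.
  rewrite (eq_integral (fun y => (\1_(ball 0 n) y)%:E)).
    by rewrite integral_indic// setIT; exact: mlt.
  move=> y _; rewrite /b /= ger0_norm ?indicE//.
  by rewrite integral_cst// [X in (_ * X)%E]probability_setT mule1.
have fi : (m \x rho)%E.-integrable setT f.
  apply: le_integrable bi => //; first exact/measurable_EFinP/measurable_funM.
  move=> u _; rewrite /f /b /= lee_fin normrM -[leRHS]mul1r ler_wpM2r//.
have := Fubini fi; rewrite /Rintegral => e.
apply: (congr1 fine); rewrite [LHS](eq_measure_integral m)// integral_mkcond.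
transitivity (\int[m]_y \int[rho]_z f (y, z))%E.
  apply: eq_integral => y _; rewrite patchE; case: ifPn => yB.
    rewrite /= fineK; last exact: (integrable_fin_num measurableT (kz y)).
    by apply: eq_integral => z _; rewrite /f indicE yB mulr1.
  by rewrite integral0_eq// => z _; rewrite /f indicE (negbTE yB) mulr0.
rewrite e; apply: eq_integral => z _.
rewrite fineK; last exact: (integrable_fin_num mB (ky z)).
rewrite [RHS](eq_measure_integral m)// [RHS]integral_mkcond; apply: eq_integral => y _; rewrite patchE /f indicE.
by case: ifPn => _; rewrite ?mulr1 ?mulr0.
Qed.

Lemma padic_psi_kernel_locconst (x : K) (u : K * K) : exists N : nat, forall v : K * K,
  nrm (v.1 - u.1) <= P ^ (- N%:Z) -> nrm (v.2 - u.2) <= P ^ (- N%:Z) ->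
  psi ((x - v.2) * v.1) = psi ((x - u.2) * u.1).
Proof.
have [a ya] := padic_norm_leXn p_prime u.1.
have [b zb] := padic_norm_leXn p_prime (x - u.2).
exists (a + b)%N => v v1 v2; apply: padic_psi_locconst => //.
(* every term on the right is a product with a small factor *)
have -> : (x - v.2) * v.1 - (x - u.2) * u.1 =
    (x - u.2) * (v.1 - u.1) - (v.2 - u.2) * (v.1 - u.1) - (v.2 - u.2) * u.1 by ring.
have ab_ge0 : P ^ (- (a + b)%N%:Z) <= 1 by rewrite -(expr0z P) pz_le//; lia.
have small (d e : K) (i : nat) : nrm d <= P ^ (- (a + b)%N%:Z) -> nrm e <= P ^+ i ->
    (i <= a + b)%N -> nrm (d * e) <= 1.
  move=> hd he hi; rewrite padic_normM.
  apply: (le_trans (ler_pM (padic_norm_ge0 _) (padic_norm_ge0 _) hd he)).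
  by rewrite exprnP -expfzDr ?p_neq0// -(expr0z P) pz_le//; lia.
have d1 : nrm (v.1 - u.1) <= P ^+ 0 by exact: le_trans v1 ab_ge0.
have h1 : nrm ((x - u.2) * (v.1 - u.1)) <= 1.
  by rewrite mulrC; apply: small v1 zb _; rewrite leq_addl.
have h2 : nrm ((v.2 - u.2) * (v.1 - u.1)) <= 1 := small _ _ _ v2 d1 (leq0n _).
have h3 : nrm ((v.2 - u.2) * u.1) <= 1 := small _ _ _ v2 ya (leq_addr _ _).
exact: (padic_normB_le (padic_normB_le h1 h2) h3).
Qed.

(** Cutting off the inverse Fourier integral at radius p^n averages the measure over
    balls of radius p^-n: after Fubini the inner integral is that of
    y |-> chi((x - z) y) over the ball, which is p^n or 0 according as z lies in
    that ball around x or not. *)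
Lemma cintegral_fourier_ball (rho : probability K R) (x : K) (n : nat) :
  cintegral mu (ball 0 n%:Z) (fun y => psi (x * y) * fourier rho y) =
  (P ^+ n * fine (rho (ball x (- n%:Z))))%:C%C.
Proof.
have psi_int (y : K) : cintegrable rho setT (fun z => psi (y * z)).
  apply: (cintegrable_psi p_prime) => //.
  by rewrite [X in (X < _)%E]probability_setT ltry.
have fE y : psi (x * y) * fourier rho y =
    cintegral rho setT (fun z => psi ((x - z) * y)).
  rewrite /fourier -cintegralZl//.
    apply: eq_cintegral => z _; rewrite padic_charE -(padic_psiD p_prime).
    by rewrite mulrBl mulNr.
  rewrite (_ : (fun z => _) = (fun z => psi (- y * z))); first exact: psi_int.
  by apply/funext => z; rewrite padic_charE !mulNr [z * y]mulrC.
rewrite (eq_cintegral mu (fun y _ => fE y)).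
have cb z : cintegral mu (ball 0 n%:Z) (fun y => psi ((x - z) * y)) =
    (P ^+ n * \1_(ball x (- n%:Z)) z)%:C%C.
  rewrite (cintegral_psi_ball p_prime mu_haar) /ball_mass indicE.
  rewrite (_ : (z \in _) = (nrm (x - z) <= P ^ (- n%:Z))).
    by case: ifP => _; rewrite ?mulr1 ?mulr0.
  by rewrite padic_normBC; apply/idP/idP => [/set_mem//|/mem_set].
have mBx := measurable_padic_ball p_prime x (- n%:Z).
rewrite {1}/cintegral; congr (_ +i* _)%C.
- rewrite (@Fubini_locconst rho (fun u => complex.Re (psi ((x - u.2) * u.1)))).
  + transitivity (\int[rho]_z (P ^+ n * \1_(ball x (- n%:Z)) z)).
      by apply: eq_Rintegral => z _; have [-> _] := cb z.
    rewrite RintegralZl//; last exact: integrable_indic.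
    by rewrite /Rintegral integral_indic// setIT.
  + move=> u; have [N HN] := padic_psi_kernel_locconst x u.
    by exists N => v v1 v2; rewrite HN.
  + by move=> u; exact: norm_Re_padic_psi.
- rewrite (@Fubini_locconst rho (fun u => complex.Im (psi ((x - u.2) * u.1)))).
  + transitivity (\int[rho]_z (0 : R)).
      by apply: eq_Rintegral => z _; have [_ ->] := cb z.
    by rewrite Rintegral_cst// mul0r.
  + move=> u; have [N HN] := padic_psi_kernel_locconst x u.
    by exists N => v v1 v2; rewrite HN.
  + by move=> u; exact: norm_Im_padic_psi.
Qed.

(** The balls of radius p^-n have mass p^-n, so the left-hand side is an average of
    g over smaller and smaller neighbourhoods of x. *)
Lemma cvg_density_ball (rho : {measure set K -> \bar R}) (g : K -> R) (x : K) :
  continuous g -> has_density mu rho g ->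
  P ^+ n * fine (rho (ball x (- n%:Z))) @[n --> \oo] --> g x.
Proof.
move=> gc [mg g0 gE]; apply/cvgrPdist_le => e e0.
have /(nbhs_padicP p_prime)[N HN] : nbhs x [set z | `|g x - g z| < e].
  by move/cvgrPdist_lt: (gc x); exact.
exists N => // n /= Nn.
set B := ball x (- n%:Z).
have gB z : B z -> `|g x - g z| < e.
  by move=> Bz; apply: HN; apply: (le_trans Bz); rewrite pz_le//; lia.
have mB : measurable B := measurable_padic_ball p_prime x (- n%:Z).
have Boo : (mu B < +oo)%E := haar_ball_lty p_prime mu_haar x (- n%:Z).
have ci (r : R) : mu.-integrable B (EFin \o (fun=> r)).
  by apply: (@bounded_integrable _ _ mu B (fun=> r) `|r|) => //; exact: measurable_cst.
have gi : mu.-integrable B (EFin \o g).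
  apply: (@bounded_integrable _ _ mu B g (`|g x| + e)) => // z /gB h.
  by rewrite -[g z](subKr (g x)) (le_trans (ler_normB _ _))// lerD2l ltW.
have PP : P ^+ n * P ^ (- n%:Z) = 1.
  by rewrite exprnP -expfzDr ?p_neq0// subrr.
have P0 : 0 <= P ^+ n by rewrite exprn_ge0// ltW// p_gt0.
have cB (r : R) : P ^+ n * \int[mu]_(z in B) r = r.
  by rewrite Rintegral_cst// [mu B](haar_ball p_prime mu_haar) /= mulrCA PP mulr1.
have -> : fine (rho B) = \int[mu]_(z in B) g z by rewrite gE.
rewrite distrC ler_norml; apply/andP; split.
- rewrite lerBrDr addrC -[leLHS]cB ler_wpM2l//.
  apply: le_Rintegral => // z /gB; rewrite ltr_norml => /andP[_]; lra.
- rewrite lerBlDr addrC -[leRHS]cB ler_wpM2l//.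
  apply: le_Rintegral => // z /gB; rewrite ltr_norml => /andP[]; lra.
Qed.

Variables (c gamma t : R) (c_gt0 : 0 < c) (gamma_gt0 : 0 < gamma) (t_gt0 : 0 < t).

Lemma density_eq_stable_density (rho : probability K R) (g : K -> R) :
  (forall y, fourier rho y = (stable_cf c gamma t y)%:C%C) ->
  continuous g -> has_density mu rho g ->
  forall x, (g x)%:C%C = stable_density mu c gamma t x.
Proof.
move=> rhoE gc gd x; have [fr fi] := cintegrable_stable p_prime mu_haar c_gt0 gamma_gt0 t_gt0 x.
have mB (n : nat) : measurable (ball 0 n%:Z) := measurable_padic_ball p_prime (0 : K) n%:Z.
have ex (y : K) : y != 0 -> exists N, forall n : nat, (N <= n)%N -> ball 0 n%:Z y.
  by move=> _; exact: padic_ball_exhaust.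
have cR := cvg_Rintegral_exhaustion p_prime mu_haar fr mB ex.
have cI := cvg_Rintegral_exhaustion p_prime mu_haar fi mB ex.
have e (n : nat) : cintegral mu (ball 0 n%:Z)
    (fun y => padic_char y x * (stable_cf c gamma t y)%:C%C) =
    (P ^+ n * fine (rho (ball x (- n%:Z))))%:C%C.
  by rewrite -cintegral_fourier_ball; apply: eq_cintegral => y _; rewrite rhoE.
apply/esym; congr (_ +i* _)%C.
have cD := @cvg_density_ball rho g x gc gd.
- apply: (cvg_near_unique (N := 0) _ cR cD) => N _.
  by have [-> _] := e N.
- apply: (cvg_near_unique (N := 0) _ cI (cvg_cst 0)) => N _.
  by have [_ ->] := e N.
Qed.

End FourierInversion.

Theorem theorem6p3 (R : realType) (p : nat) (p_prime : prime p)
  (mu : {measure set (padic R p) -> \bar R}) (mu_haar : normalized_haar mu)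
  (c gamma : R) (c_gt0 : 0 < c) (gamma_gt0 : 0 < gamma) (t : R) (t_gt0 : 0 < t) :
  (forall (rho : probability (padic R p) R) (g : padic R p -> R),
     (forall y, fourier rho y = (stable_cf c gamma t y)%:C%C) ->
     continuous g -> has_density mu rho g ->
     forall x, (g x)%:C%C = stable_density mu c gamma t x) /\
  (forall x : padic R p, x != 0 ->
     series (fun n : nat => (-1) ^+ n / n`!%:R *
         ((c * t) ^+ n / padic_norm x `^ (n%:R * gamma + 1))%:C%C *
         padic_Gamma mu (n%:R * gamma + 1) : R[i]^o)
       @ \oo --> (stable_density mu c gamma t x : R[i]^o)).
Proof.
split=> [rho g|x x0].
  exact: density_eq_stable_density.
exact: stable_density_series.
Qed.
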